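(* Let $n$ be a nonnegative integer and let $K\subset\mathbb{R}^n$ be a solid order cone that is a polyhedron. Let $X\subset\mathbb{R}^n$ be a nonempty set whose interior $\operatorname{int}X$ is connected and dense in $X$. Let $T\colon X\to X$ be an injective continuous map that is monotone for the $K$-order. If $T$ is (real) analytic on $\operatorname{int}X$ and $T$ is not periodic, then the set $\mathcal{P}(T)$ of periodic points of $T$ is nowhere dense in $X$.
   Context: A solid order cone $K\subset\mathbb{R}^n$ is a closed convex cone that is solid (has nonempty interior $\operatorname{int}K$) and pointed (contains no affine line). A polyhedron is an intersection of finitely many closed affine halfspaces of $\mathbb{R}^n$. The $K$-order on $\mathbb{R}^n$ is the partial order given by $y\succeq x \iff y-x\in K$. A map $T$ is monotone for the $K$-order if $x\succeq y$ implies $Tx\succeq Ty$. For a positive integer $k$, a point $x$ has period $k$ if $T^kx=x$ (the period need not be minimal); $\mathcal{P}_k(T)$ is the set of such points, and $\mathcal{P}(T)=\bigcup_{k\ge1}\mathcal{P}_k(T)$ is the set of periodic points. $T$ is periodic if $X=\mathcal{P}_k(T)$ for some positive integer $k$. *)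

(* Defs.v *)
(* MathComp / MathComp-Analysis; vectors of R^n are row vectors 'rV[R]_n.     *)
From HB Require Import structures.
From mathcomp Require Import all_boot all_order all_algebra.
From mathcomp Require Import all_classical all_reals all_analysis.

Set Implicit Arguments.
Unset Strict Implicit.
Unset Printing Implicit Defensive.

Import Order.TTheory GRing.Theory Num.Theory.
Import numFieldNormedType.Exports.

Local Open Scope classical_set_scope.
Local Open Scope ring_scope.

Section cones.
Context {R : realType} {n : nat}.
Implicit Types K : set 'rV[R]_n.

Definition is_cone K := forall (t : R) x, 0 <= t -> K x -> K (t *: x).

Definition is_line (L : set 'rV[R]_n) :=
  exists x v : 'rV[R]_n, v != 0 /\ L = [set x + t *: v | t in [set: R]].

Definition pointed_set K := ~ exists L, is_line L /\ L `<=` K.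

Definition solid_order_cone K :=
  [/\ closed K, convex_set (K : set (convex_lmodType 'rV[R]_n)), is_cone K,
      K° !=set0 & pointed_set K].

Definition closed_halfspace (a : 'rV[R]_n) (b : R) : set 'rV[R]_n :=
  [set x | \sum_i a 0 i * x 0 i <= b].

(* m = 0 gives the whole space. *)
Definition is_polyhedron K :=
  exists (m : nat) (a : 'I_m -> 'rV[R]_n) (b : 'I_m -> R),
    (forall i, a i != 0) /\
    K = \bigcap_(i in [set: 'I_m]) closed_halfspace (a i) (b i).

Definition cone_le K (x y : 'rV[R]_n) : Prop := K (y - x).

End cones.

Section periodicity.
Context {U : Type}.

(* The period k need not be minimal. *)
Definition periodic_points_of (T : U -> U) (k : nat) : set U :=
  [set x | iter k T x = x].

Definition periodic_points (T : U -> U) : set U :=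
  \bigcup_(k in [set k | (0 < k)%N]) periodic_points_of T k.

Definition periodic_map (T : U -> U) : Prop :=
  exists k : nat, (0 < k)%N /\ [set: U] = periodic_points_of T k.

End periodicity.

Definition nowhere_dense {S : topologicalType} (A : set S) : Prop :=
  (closure A)° = set0.

Section analyticity.
Context {R : realType} {n : nat}.

Definition monomial (alpha : {ffun 'I_n -> nat}) (v : 'rV[R]_n) : R :=
  \prod_i v 0 i ^+ alpha i.

(* The power series with coefficients c converges absolutely at v, with sum   *)
(* s. As esum is meant for nonnegative terms, the sum is computed as that of  *)
(* the positive parts minus that of the negative parts.                       *)
Definition power_series_sum (c : {ffun 'I_n -> nat} -> R) (v : 'rV[R]_n) (s : R) :=
  let term := fun alpha : {ffun 'I_n -> nat} => (c alpha * monomial alpha v)%:E in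
  summable setT term /\
  (\esum_(alpha in setT) term^\+ alpha
   - \esum_(alpha in setT) term^\- alpha = s%:E)%E.

(* A map f defined on X is analytic on the interior of X: each coordinate of  *)
(* f is given, around each interior point a, by a power series centered at a. *)
(* "x \near a" refers to the topology of the subspace X, whose neighbourhoods *)
(* of an interior point a are, up to shrinking, those of R^n.                 *)
Definition analytic_on_interior {m : nat} (X : set 'rV[R]_n)
    (f : X -> 'rV[R]_m) : Prop :=
  forall a : X, X° (val a) -> forall j : 'I_m,
  exists c : {ffun 'I_n -> nat} -> R,
    \forall x \near a, power_series_sum c (val x - val a) (f x 0 j).

End analyticity.

(* Main.v *)
(* Write K as {x | phi_i x >= 0 for all i}, with irredundant functionals      *)
(* phi_0, ..., phi_(m-1). Locally, the K-order contains the standard example  *)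
(* of order dimension m. Hence an order embedding G of a dense set of points  *)
(* into R^n permutes the functionals: there is a permutation s such that      *)
(* phi_i y < phi_i x implies phi_(s i) (G y) < phi_(s i) (G x).               *)
(* If periodic points are dense in an open set, then two of them, p << q,     *)
(* bound an order interval invariant under some iterate G of T. Monotone maps *)
(* reflect the order between periodic points, so that G permutes the phi_i,   *)
(* and a power of G is strictly increasing in each phi_i separately; it then  *)
(* fixes all periodic points of the interval, hence the whole interval.       *)
(* So T^N = id on some open set, where T is an order embedding and thus has   *)
(* the product form: phi_(s i) (T x) only depends on phi_i x. The product     *)
(* form extends to int X by the identity theorem along segments, and with     *)
(* the injectivity of T it implies T(int X) <= int X. It also makes each      *)
(* phi_i o T^N analytic along segments by composition of functions of one     *)
(* variable, so that T^N = id extends to int X, and to X by density.          *)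
Require Import Defs.
From HB Require Import structures.
From mathcomp Require Import all_boot all_order all_algebra fingroup perm.
From mathcomp Require Import all_classical all_reals all_analysis.
From mathcomp Require Import ring lra.
Import Order.TTheory GRing.Theory Num.Theory.
Import numFieldNormedType.Exports.
Local Open Scope classical_set_scope.
Local Open Scope ring_scope.

(** * Analytic functions of one variable *)

(** Suppose that the periodic points are dense in some open subset of [X]; then T^N = id is to be
    shown for some N > 0. The facet functionals of K turn the K-order into a coordinatewise order.
    The combinatorial core is [facet_permutation]: a map of a dense set that preserves and reflects
    this order permutes the functionals, as far as strict inequalities go. Between periodic points T
    reflects the order, so on an order interval with periodic ends a suitable iterate is strictly
    increasing in each functional, and a periodic orbit that is strictly monotone in a functional is
    impossible ([periodic_on_cube]). By continuity T^N = id on a cube.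

    To spread this over int X, the identity theorem cannot be applied to T^N at once: T is analytic
    only on int X, which is not yet known to be invariant. The product form of T ([local_product])
    is spread first ([product_propagates]); it yields invariance ([product_interior]) and the
    analyticity of the iterates along segments ([facet_iter_analytic]). The identity theorem then
    applies to T^N ([periodic_on_interior]).

    Analyticity is only ever used along segments. It is expressed by limits of polynomials in the
    l^1 norm of the coefficients, for which composition ([analytic_at_comp]) and the identity
    theorem ([analytic_identity]) reduce to estimates on finite sums. *)

Section WienerNorm.
Context {R : realType}.
Implicit Types (p q : {poly R}) (s c t r eps : R).

(** The l^1 norm of the coefficients: submultiplicative, and a bound for the polynomial on
    [-1, 1]. *)
Definition wnorm p : R := \sum_(i < size p) `|p`_i|.

Lemma wnormE p d : (size p <= d)%N -> wnorm p = \sum_(i < d) `|p`_i|.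
Proof.
move=> pd; rewrite /wnorm (big_ord_widen _ (fun i => `|p`_i|) pd) big_mkcond /=.
by apply: eq_bigr => i _; case: ltnP => // le_p_i; rewrite nth_default ?normr0.
Qed.

Lemma wnorm_ge0 p : 0 <= wnorm p.
Proof. exact: sumr_ge0. Qed.

Lemma wnormD p q : wnorm (p + q) <= wnorm p + wnorm q.
Proof.
pose d := maxn (size p) (size q).
rewrite (@wnormE _ d) ?size_polyD // (@wnormE p d) ?leq_maxl //.
rewrite (@wnormE q d) ?leq_maxr // -big_split /=.
by apply: ler_sum => i _; rewrite coefD ler_normD.
Qed.

Lemma wnormN p : wnorm (- p) = wnorm p.
Proof. by rewrite /wnorm size_polyN; apply: eq_bigr => i _; rewrite coefN normrN. Qed.

Lemma wnormC c : wnorm c%:P = `|c|.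
Proof.
by rewrite (@wnormE _ 1) ?size_polyC ?leq_b1 // big_ord1 coefC eqxx.
Qed.

Lemma wnorm0 : wnorm 0 = 0.
Proof. by rewrite -[0]/(0%:P) wnormC normr0. Qed.

Lemma wnorm_sub p q : wnorm (p - q) = wnorm (q - p).
Proof. by rewrite -wnormN opprB. Qed.

Lemma wnorm_triangle q p (r : {poly R}) : wnorm (p - r) <= wnorm (p - q) + wnorm (q - r).
Proof. by rewrite -{1}[p](subrK q) -addrA wnormD. Qed.

Lemma wnorm_cons p c : wnorm (p * 'X + c%:P) = wnorm p + `|c|.
Proof.
rewrite (@wnormE _ (size p).+1); last by rewrite size_MXaddC; case: ifP.
rewrite big_ord_recl coefD coefMX coefC /= add0r addrC; congr (_ + _).
by apply: eq_bigr => i _; rewrite coefD coefMX coefC /= addr0.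
Qed.

Lemma wnormM p q : wnorm (p * q) <= wnorm p * wnorm q.
Proof.
have wnormZ c (r : {poly R}) : wnorm (c%:P * r) <= `|c| * wnorm r.
  rewrite mul_polyC (@wnormE _ (size r)) ?size_scale_leq // /wnorm mulr_sumr.
  by apply: ler_sum => i _; rewrite coefZ normrM.
have wnormX (r : {poly R}) : wnorm (r * 'X) = wnorm r.
  by rewrite -[r * 'X]addr0 -[0]/(0%:P) wnorm_cons normr0 addr0.
elim/poly_ind: p => [|p c IH]; first by rewrite mul0r wnorm0 mul0r.
rewrite wnorm_cons mulrDl mulrDl -mulrA (mulrC 'X) mulrA.
by apply: le_trans (wnormD _ _) _; rewrite lerD // wnormX.
Qed.

Lemma horner_wnorm p s : `|s| <= 1 -> `|p.[s]| <= wnorm p.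
Proof.
move=> s1; elim/poly_ind: p => [|p c IH]; first by rewrite horner0 normr0 wnorm0.
rewrite !hornerE wnorm_cons; apply: le_trans (ler_normD _ _) _.
by rewrite lerD // normrM (le_trans _ IH) // ler_piMr.
Qed.

Lemma wnorm_comp p q : wnorm q <= 1 -> wnorm (p \Po q) <= wnorm p.
Proof.
move=> q1; elim/poly_ind: p => [|p c IH]; first by rewrite comp_poly0 wnorm0.
rewrite comp_poly_MXaddC wnorm_cons; apply: le_trans (wnormD _ _) _.
rewrite wnormC lerD2r; apply: le_trans (wnormM _ _) _.
by rewrite (le_trans _ IH) // ler_piMr // wnorm_ge0.
Qed.

(** Telescoping in the Horner scheme. [L] depends on [p], which forces the diagonal choice in
    [analytic_at_comp]. *)
Lemma wnorm_comp_lipschitz p : exists2 L, 0 < L & forall q1 q2,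
  wnorm q1 <= 1 -> wnorm q2 <= 1 ->
  wnorm ((p \Po q1) - (p \Po q2)) <= L * wnorm (q1 - q2).
Proof.
elim/poly_ind: p => [|p c [L L0 IH]].
  by exists 1 => // q1 q2 _ _; rewrite !comp_poly0 subr0 wnorm0 mul1r wnorm_ge0.
exists (L + wnorm p) => [|q1 q2 h1 h2]; first by rewrite ltr_pwDl ?wnorm_ge0.
rewrite !comp_poly_MXaddC.
have -> : (p \Po q1) * q1 + c%:P - ((p \Po q2) * q2 + c%:P) =
   ((p \Po q1) - (p \Po q2)) * q1 + (p \Po q2) * (q1 - q2) by ring.
apply: le_trans (wnormD _ _) _; rewrite [leRHS]mulrDl lerD //.
  apply: le_trans (wnormM _ _) _; apply: le_trans (IH _ _ h1 h2).
  by rewrite ler_piMr // wnorm_ge0.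
by apply: le_trans (wnormM _ _) _; rewrite ler_wpM2r ?wnorm_ge0 // wnorm_comp.
Qed.

Lemma wnorm_scaleX c : wnorm (c *: 'X) = `|c|.
Proof. by rewrite -mul_polyC -[_ * _]addr0 -[0]/(0%:P) wnorm_cons normr0 addr0 wnormC. Qed.

Lemma wnorm_comp_scaleX p c : `|c| <= 1 ->
  wnorm ((p \Po (c *: 'X)) - (p`_0)%:P) <= `|c| * wnorm p.
Proof.
move=> c1; elim/poly_ind: p => [|p b _].
  by rewrite comp_poly0 coef0 subr0 !wnorm0 mulr0.
rewrite comp_poly_MXaddC coefD coefMX coefC /= add0r addrK wnorm_cons.
apply: le_trans (wnormM _ _) _; rewrite wnorm_scaleX mulrC ler_wpM2l //.
apply: (@le_trans _ _ (wnorm p)); last by rewrite lerDl.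
by apply: wnorm_comp; rewrite wnorm_scaleX.
Qed.

Definition wcauchy (u : nat -> {poly R}) := forall eps, 0 < eps ->
  exists M, forall i j, (M <= i)%N -> (M <= j)%N -> wnorm (u i - u j) <= eps.

Lemma wcauchy_bounded u : wcauchy u -> exists2 B, 0 < B & exists M, forall i,
  (M <= i)%N -> wnorm (u i) <= B.
Proof.
move=> /(_ 1 ltr01) [M HM]; exists (1 + wnorm (u M)).
  by rewrite ltr_pwDl ?wnorm_ge0.
exists M => i Mi; rewrite -{1}[u i](subrK (u M)).
by apply: le_trans (wnormD _ _) _; rewrite lerD2r HM.
Qed.

(* Limits of polynomials in the Wiener norm play the role of power series, so *)
(* that composing them only involves finite sums.                             *)
Definition wlimit (u : nat -> {poly R}) (h : R -> R) := wcauchy u /\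
  forall s eps, `|s| <= 1 -> 0 < eps ->
  exists M, forall i, (M <= i)%N -> `|(u i).[s] - h s| <= eps.

(** The factor [r] rescales a neighbourhood of [t] to [-1, 1], where [h] is the sum of a power
    series with absolutely summable coefficients. *)
Definition analytic_at (h : R -> R) (t : R) :=
  exists r u, 0 < r /\ wlimit u (fun s => h (t + r * s)).

Lemma analytic_at_shrink h t (l : R) r u : 0 < l <= 1 ->
  wlimit u (fun s => h (t + r * s)) ->
  wlimit (fun i => u i \Po (l *: 'X)) (fun s => h (t + (l * r) * s)).
Proof.
move=> /andP[l0 l1] [uC uh]; have ll : `|l| = l by rewrite gtr0_norm.
split=> [eps eps0|s eps s1 eps0].
  have [M HM] := uC _ eps0; exists M => i j Mi Mj; rewrite -comp_polyB.
  by apply: le_trans (HM i j Mi Mj); rewrite wnorm_comp // wnorm_scaleX ll.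
have ls : `|l * s| <= 1 by rewrite normrM ll mulr_ile1 // ltW.
have [M HM] := uh _ _ ls eps0; exists M => i Mi.
by rewrite horner_comp !hornerE (mulrC l r) -mulrA; exact: HM.
Qed.

Lemma analytic_at_near h1 h2 t r : 0 < r ->
  (forall s, `|s - t| < r -> h1 s = h2 s) -> analytic_at h1 t -> analytic_at h2 t.
Proof.
move=> r0 h12 [r1 [u [r10 uh]]].
pose l := Num.min 1 (r / (r1 * 2)).
have l0 : 0 < l by rewrite lt_min ltr01 divr_gt0 // mulr_gt0.
have l1 : 0 < l <= 1 by rewrite l0 ge_min lexx.
exists (l * r1), (fun i => u i \Po (l *: 'X)); split; first exact: mulr_gt0.
have [uC uP] := analytic_at_shrink _ _ _ _ _ l1 uh.
split=> // s eps s1 eps0; rewrite -h12; first exact: uP.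
rewrite addrC addKr normrM gtr0_norm ?mulr_gt0 //.
apply: (@le_lt_trans _ _ (l * r1)); first by rewrite ler_piMr // ltW // mulr_gt0.
have : l <= r / (r1 * 2) by rewrite ge_min lexx orbT.
rewrite -(ler_pM2r r10) => /le_lt_trans; apply.
rewrite invfM mulrA mulrAC mulfVK ?gt_eqF //; lra.
Qed.

Lemma analytic_at_affine (a b t : R) : analytic_at (fun s => a + b * s) t.
Proof.
exists 1, (fun=> (a + b * t)%:P + b *: 'X); split=> //; split=> [eps eps0|s eps _ eps0].
  by exists 0%N => i j _ _; rewrite subrr wnorm0 ltW.
exists 0%N => i _; rewrite !hornerE.
by rewrite [X in `|X|](_ : _ = 0) ?normr0 ?ltW //; ring.
Qed.

Lemma analytic_atD (h1 h2 : R -> R) t :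
  analytic_at h1 t -> analytic_at h2 t -> analytic_at (fun s => h1 s + h2 s) t.
Proof.
move=> [r1 [u1 [r10 uh1]]] [r2 [u2 [r20 uh2]]].
wlog le_r : h1 h2 r1 r2 u1 u2 r10 r20 uh1 uh2 / r1 <= r2.
  move=> H; have [|] := leP r1 r2; first by move=> ?; apply: (H h1 h2 r1 r2 u1 u2).
  move=> /ltW ?; have := H h2 h1 r2 r1 u2 u1 r20 r10 uh2 uh1.
  by rewrite (_ : (fun s => h2 s + h1 s) = (fun s => h1 s + h2 s)); [apply | apply/funext => s; rewrite addrC].
have l1 : 0 < r1 / r2 <= 1 by rewrite divr_gt0 //= ler_pdivrMr // mul1r.
have := analytic_at_shrink _ _ _ _ _ l1 uh2; rewrite divfK ?gt_eqF //.
set u := (fun i => _); move=> [uC uP]; have [vC vP] := uh1.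
exists r1, (fun i => u1 i + u i); split=> //; split=> [eps eps0|s eps s1 eps0].
  have e2 : 0 < eps / 2 by rewrite divr_gt0.
  have [M1 H1] := uC _ e2; have [M2 H2] := vC _ e2.
  exists (maxn M1 M2) => i j; rewrite !geq_max => /andP[i1 i2] /andP[j1 j2].
  rewrite opprD addrACA; apply: le_trans (wnormD _ _) _.
  by rewrite [leRHS]splitr lerD // ?H1 ?H2.
have e2 : 0 < eps / 2 by rewrite divr_gt0.
have [M1 H1] := uP _ _ s1 e2; have [M2 H2] := vP _ _ s1 e2.
exists (maxn M1 M2) => i; rewrite !geq_max => /andP[i1 i2].
rewrite hornerD opprD addrACA; apply: le_trans (ler_normD _ _) _.
by rewrite [leRHS]splitr lerD // ?H1 ?H2.
Qed.

(** Once the inner polynomials are centred and scaled to norm at most 1, substituting them does not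
    increase the norm, so errors in the outer function pass through unchanged. Errors in the inner
    function are multiplied by a constant depending on the outer polynomial; a diagonal sequence
    absorbs this. *)
Lemma analytic_at_comp (f g : R -> R) t :
  analytic_at g t -> analytic_at f (g t) -> analytic_at (f \o g) t.
Proof.
move=> [rg [u [rg0 uh]]] [rf [v [rf0 [vC vP]]]].
have [B B0 [M0 HB]] := wcauchy_bounded _ uh.1.
(* The nonconstant part of [u i \Po (l *: 'X)] has norm at most [l * B], which must fit into the
   radius [rf] of the outer function. *)
pose l := Num.min 1 (rf / B).
have l0 : 0 < l by rewrite lt_min ltr01 divr_gt0.
have l1 : 0 < l <= 1 by rewrite l0 ge_min lexx.
have lB : l * B <= rf by rewrite -ler_pdivlMr // ge_min lexx orbT.
have [wC wP] := analytic_at_shrink _ _ _ _ _ l1 uh.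
pose w i := (rf^-1)%:P * ((u (i + M0)%N \Po (l *: 'X)) - ((u (i + M0)%N)`_0)%:P).
have ll : `|l| = l by rewrite gtr0_norm.
have rfV : `|rf^-1| = rf^-1 by rewrite gtr0_norm // invr_gt0.
have w1 i : wnorm (w i) <= 1.
  apply: le_trans (wnormM _ _) _; rewrite wnormC rfV mulrC ler_pdivrMr // mul1r.
  apply: le_trans (wnorm_comp_scaleX _ _ _) _; first by rewrite ll; case/andP: l1.
  rewrite ll; apply: le_trans lB; rewrite ler_wpM2l ?(ltW l0) // HB //.
  by rewrite leq_addl.
pose G s := (g (t + l * rg * s) - g t) / rf.
have wG s eps : `|s| <= 1 -> 0 < eps ->
    exists M, forall i, (M <= i)%N -> `|(w i).[s] - G s| <= eps.
  move=> s1 eps0; have e2 : 0 < eps * rf / 2 by rewrite divr_gt0 // mulr_gt0.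
  have [M1 H1] := wP _ _ s1 e2.
  have s0 : `|0 : R| <= 1 by rewrite normr0.
  have [M2 H2] := wP _ _ s0 e2.
  exists (maxn M1 M2) => i; rewrite geq_max => /andP[i1 i2].
  have := H1 _ (leq_trans i1 (leq_addr M0 i)).
  have := H2 _ (leq_trans i2 (leq_addr M0 i)).
  rewrite /w /G !(horner_comp, hornerE) horner_coef0.
  set a := (u _)`_0; set b := (u _).[_]; set c := g (t + _) => Ha Hb.
  rewrite mulrC -mulrBl normrM rfV ler_pdivrMr //.
  have -> : b - a - (c - g t) = (b - c) - (a - g t) by ring.
  apply: le_trans (ler_normB _ _) _; lra.
have wwC : wcauchy w.
  move=> eps eps0; have e2 : 0 < eps * rf / 2 by rewrite divr_gt0 // mulr_gt0.
  have [M1 H1] := wC _ e2; exists M1 => i j i1 j1.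
  have {}i1 := leq_trans i1 (leq_addr M0 i); have {}j1 := leq_trans j1 (leq_addr M0 j).
  rewrite /w -mulrBr; apply: le_trans (wnormM _ _) _.
  rewrite wnormC rfV mulrC ler_pdivrMr //.
  have /= := H1 _ _ i1 j1.
  set p := (_ \Po _); set q := (_ \Po _); set a := (u _)`_0; set b := (u _)`_0 => Hpq.
  have -> : p - a%:P - (q - b%:P) = (p - q) - (a - b)%:P by rewrite polyCB; ring.
  apply: le_trans (wnormD _ _) _; rewrite wnormN wnormC.
  have : `|a - b| <= wnorm (p - q).
    have -> : a - b = (p - q).[0].
      by rewrite !(horner_comp, hornerE) !horner_coef0.
    by apply: horner_wnorm; rewrite normr0.
  lra.
have G1 s : `|s| <= 1 -> `|G s| <= 1.
  move=> s1; apply/ler_addgt0Pr => eps eps0; have [M HM] := wG _ _ s1 eps0.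
  have := HM M (leqnn M); have := horner_wnorm (w M) _ s1; have := w1 M.
  rewrite -{2}[G s](subKr (w M).[s]) => ? ? ?.
  by apply: le_trans (ler_normB _ _) _; lra.
(* [k i] is so late that replacing the inner polynomial of [v i] by any later one changes the
   composite by at most 1 / (i + 1). *)
have /choice [k Hk] : forall i, exists M, forall j, (M <= j)%N ->
    wnorm ((v i \Po w M) - (v i \Po w j)) <= (i.+1%:R)^-1.
  move=> i; have [L L0 HL] := wnorm_comp_lipschitz (v i).
  have e0 : 0 < (i.+1%:R)^-1 / L by rewrite divr_gt0 // invr_gt0.
  have [M HM] := wwC _ e0; exists M => j Mj; apply: le_trans (HL _ _ (w1 _) (w1 _)) _.
  by rewrite mulrC -ler_pdivlMr // HM.
have inv_small (eps : R) : 0 < eps -> exists M, forall i, (M <= i)%N -> (i.+1%:R)^-1 <= eps.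
  move=> eps0; exists (Num.trunc (eps^-1)) => i Mi.
  rewrite invf_ple ?posrE //; apply: ltW; apply: lt_le_trans (truncnS_gt _) _.
  by rewrite ler_nat ltnS.
exists (l * rg), (fun i => v i \Po w (k i)); split; first exact: mulr_gt0.
split=> [eps eps0|s eps s1 eps0].
  have e3 : 0 < eps / 3 by rewrite divr_gt0.
  have [M1 H1] := inv_small _ e3; have [M2 H2] := vC _ e3.
  exists (maxn M1 M2) => i j; rewrite !geq_max => /andP[i1 i2] /andP[j1 j2].
  (* Both composites are compared through one common inner polynomial [w n]. *)
  pose n := maxn (k i) (k j).
  apply: le_trans (wnorm_triangle (v i \Po w n) _ _) _.
  have A1 := le_trans (Hk i n (leq_maxl _ _)) (H1 _ i1).
  have A2 := le_trans (Hk j n (leq_maxr _ _)) (H1 _ j1).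
  have := wnorm_triangle (v j \Po w n) (v i \Po w n) (v j \Po w (k j)).
  rewrite -comp_polyB (wnorm_sub (v j \Po w n)).
  have := le_trans (wnorm_comp (v i - v j) _ (w1 n)) (H2 _ _ i2 j2).
  lra.
have e3 : 0 < eps / 3 by rewrite divr_gt0.
have [M1 H1] := inv_small _ e3; have [M2 H2] := vP _ _ (G1 _ s1) e3.
exists (maxn M1 M2) => i; rewrite !geq_max => /andP[i1 i2].
have eG : g t + rf * G s = g (t + l * rg * s) by rewrite /G; field; lra.
have := H2 _ i2; rewrite eG => A2.
have [L L0 HL] : exists2 L : R, 0 < L & forall x y, `|x| <= 1 -> `|y| <= 1 ->
    `|(v i).[x] - (v i).[y]| <= L * `|x - y|.
  have [L L0 HL] := wnorm_comp_lipschitz (v i); exists L => // x y x1 y1.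
  have := HL x%:P y%:P; rewrite !wnormC => /(_ x1 y1).
  by rewrite !comp_polyCr -!polyCB !wnormC.
have [M3 H3] := wG _ _ s1 (divr_gt0 e3 L0).
pose n := maxn (k i) M3.
have w1s := le_trans (horner_wnorm (w n) _ s1) (w1 n).
have A3 := le_trans (HL _ _ w1s (G1 _ s1)) _.
have {}A3 : `|(v i).[(w n).[s]] - (v i).[G s]| <= eps / 3.
  by apply: A3; rewrite mulrC -ler_pdivlMr // H3 ?leq_maxr.
have := le_trans (horner_wnorm _ _ s1) (le_trans (Hk i n (leq_maxl _ _)) (H1 _ i1)).
rewrite hornerD hornerN !horner_comp => A1; rewrite /=.
move: A1 A2 A3; set x1 := horner _ _; set x2 := horner _ _; set x3 := horner _ _.
set x4 := f _ => A1 A2 A3.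
have -> : x1 - x4 = (x1 - x2) + (x2 - x3) + (x3 - x4) by ring.
apply: le_trans (ler_normD _ _) _.
have := ler_normD (x1 - x2) (x2 - x3); lra.
Qed.

End WienerNorm.

(** * The identity theorem on an interval *)

Section IdentityTheorem.
Context {R : realType}.
Implicit Types (p q : {poly R}) (s c t r eps : R).

(** Induction on [k]: when the lower coefficients tend to 0, the value at a small point isolates the
    k-th one. Only negative points are used, since a continuation argument knows the zeros only to
    the left of the point reached. *)
Lemma wcauchy_coef_to0 (u : nat -> {poly R}) d : 0 < d -> wcauchy u ->
  (forall s eps, - d < s < 0 -> 0 < eps ->
     exists M, forall i, (M <= i)%N -> `|(u i).[s]| <= eps) ->
  forall k eps, 0 < eps -> exists M, forall i, (M <= i)%N -> `|(u i)`_k| <= eps.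
Proof.
move=> d0 uC u0 k; have [B B0 [M0 HB]] := wcauchy_bounded _ uC.
elim/ltn_ind: k => k IH eps eps0.
have M1 : forall e1, 0 < e1 -> exists M, forall i, (M <= i)%N ->
    \sum_(j < k) `|(u i)`_j| <= e1.
  move: IH; elim: k => [|k IHk] IH e1 e10.
    by exists 0%N => i _; rewrite big_ord0 ltW.
  have e2 : 0 < e1 / 2 by rewrite divr_gt0.
  have [Ma Ha] := IHk (fun j jk => IH j (ltnW jk)) _ e2.
  have [Mb Hb] := IH k (leqnn _) _ e2.
  exists (maxn Ma Mb) => i; rewrite geq_max => /andP[ia ib].
  by rewrite big_ord_recr /= [leRHS]splitr lerD ?Ha ?Hb.
(* At s = - x the terms of degree > k are at most x ^+ k.+1 * B, which is     *)
(* negligible against x ^+ k.                                                 *)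
pose x := Num.min (d / 2) (Num.min 1 (eps / (B * 2))).
have x0 : 0 < x by rewrite !lt_min ltr01 !divr_gt0 ?mulr_gt0.
have xd : x < d.
  have : x <= d / 2 by rewrite ge_min lexx.
  lra.
have x1 : x <= 1 by rewrite !ge_min lexx orbT.
have xe : x * B <= eps / 2.
  have : x <= eps / (B * 2) by rewrite !ge_min lexx !orbT.
  by rewrite ler_pdivlMr ?mulr_gt0 // mulrA -ler_pdivlMr.
have e4 : 0 < eps * x ^+ k / 4 by rewrite divr_gt0 // mulr_gt0 // exprn_gt0.
have [M2 H2] := M1 _ e4.
have [|M3 H3] := u0 (- x) _ _ e4; first by rewrite ltrN2 xd oppr_lt0.
exists (maxn M0 (maxn M2 M3)) => i; rewrite !geq_max => /and3P[i0 i2 i3].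
have := HB _ i0; have := H2 _ i2; have := H3 _ i3.
set S1 := \sum_(j < k) _ => A3 A2 A0.
have nx : `|- x| = x by rewrite normrN gtr0_norm.
have key : `|(u i)`_k| * x ^+ k <= `|(u i).[- x]| + S1 + x ^+ k.+1 * B.
  pose n := (maxn (size (u i)) k.+1).
  have -> : (u i).[- x] = \sum_(j < n) (u i)`_j * (- x) ^+ j.
    by rewrite (@horner_coef_wide _ n) ?leq_maxl.
  have kn : (k < n)%N by rewrite leq_maxr.
  have wn : \sum_(j < n) `|(u i)`_j| <= B by rewrite -wnormE // leq_maxl.
  rewrite (bigD1 (Ordinal kn)) //=.
  set S2 := \sum_(j < n | _) _.
  have : `|S2| <= S1 + x ^+ k.+1 * B.
    apply: le_trans (ler_norm_sum _ _ _) _.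
    rewrite (bigID (fun j : 'I_n => (j < k)%N)) /=; apply: lerD.
      rewrite /S1 (big_ord_widen _ (fun j => `|(u i)`_j|) (ltnW kn)) big_mkcond.
      rewrite [leRHS]big_mkcond /=; apply: ler_sum => j _.
      case: (ltnP j k) => [jk|]; last by rewrite andbF.
      rewrite andbT; case: ifP => // _; rewrite normrM normrX nx ler_piMr //.
      by rewrite exprn_ile1 // ltW.
    apply: (@le_trans _ _ (x ^+ k.+1 * \sum_(j < n) `|(u i)`_j|)); last first.
      by rewrite ler_wpM2l // exprn_ge0 // ltW.
    rewrite mulr_sumr big_mkcond; apply: ler_sum => j _.
    case: ifP => [/andP[jk]|_]; last by rewrite mulr_ge0 // exprn_ge0 // ltW.
    rewrite -leqNgt => kj; rewrite normrM normrX nx mulrC ler_wpM2r //.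
    rewrite ler_wiXn2l ?(ltW x0) // ltn_neqAle kj andbT eq_sym.
    by apply: contraNneq jk => e; apply/eqP/val_inj.
  have -> : `|(u i)`_k| * x ^+ k = `|(u i)`_k * (- x) ^+ k| by rewrite normrM normrX nx.
  set a := _ * _ ^+ k => b; have -> : a = (a + S2) - S2 by rewrite addrK.
  rewrite addrK in b *; have := ler_normB (a + S2) S2; rewrite addrK; lra.
rewrite -(ler_pM2r (exprn_gt0 k x0)).
apply: le_trans key _.
have xk1 : x ^+ k <= 1 by rewrite exprn_ile1 // ltW.
have : x ^+ k.+1 * B <= x ^+ k * (eps / 2).
  by rewrite exprSr -mulrA ler_wpM2l // exprn_ge0 // ltW.
lra.
Qed.

(** The Cauchy property makes tails uniformly small: beyond the degree of [u M], the coefficients of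
    [u i] are those of [u i - u M]. Finitely many coefficients remain. *)
Lemma wcauchy_to0 (u : nat -> {poly R}) : wcauchy u ->
  (forall k eps, 0 < eps -> exists M, forall i, (M <= i)%N -> `|(u i)`_k| <= eps) ->
  forall eps, 0 < eps -> exists M, forall i, (M <= i)%N -> wnorm (u i) <= eps.
Proof.
move=> uC u0 eps eps0; have e2 : 0 < eps / 2 by rewrite divr_gt0.
have [M HM] := uC _ e2; pose n := size (u M).
have [M1 H1] : exists M1, forall i, (M1 <= i)%N -> \sum_(j < n) `|(u i)`_j| <= eps / 2.
  elim: n (eps / 2) e2 => [|n IH] e1 e10.
    by exists 0%N => i _; rewrite big_ord0 ltW.
  have e2 : 0 < e1 / 2 by rewrite divr_gt0.
  have [Ma Ha] := IH _ e2; have [Mb Hb] := u0 n _ e2.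
  exists (maxn Ma Mb) => i; rewrite geq_max => /andP[ia ib].
  by rewrite big_ord_recr /= [leRHS]splitr lerD ?Ha ?Hb.
exists (maxn M M1) => i; rewrite geq_max => /andP[iM iM1].
pose m := maxn (size (u i)) n.
have := HM _ _ iM (leqnn M); rewrite (@wnormE _ _ m); last first.
  by rewrite (leq_trans (size_polyD _ _)) // size_polyN leqnn.
rewrite (@wnormE _ _ m) ?leq_maxl // => A.
apply: (@le_trans _ _ (\sum_(j < n) `|(u i)`_j| + \sum_(j < m) `|(u i - u M)`_j|)); last first.
  by rewrite [leRHS]splitr lerD // H1.
rewrite [X in _ <= X + _](big_ord_widen m (fun j => `|(u i)`_j|)) ?leq_maxr //.
rewrite [X in _ <= X + _]big_mkcond -big_split /=; apply: ler_sum => j _.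
case: ifP => [_|/negbT]; first by rewrite lerDl.
by rewrite -leqNgt => nj; rewrite coefB [(u M)`_j]nth_default // subr0 add0r.
Qed.

Lemma analytic_at_eq0_left h t d : 0 < d -> analytic_at h t ->
  (forall s, t - d < s < t -> h s = 0) ->
  exists2 d', 0 < d' & forall s, `|s - t| <= d' -> h s = 0.
Proof.
move=> d0 [r [u [r0 [uC uP]]]] h0.
have uk := wcauchy_coef_to0 u (Num.min 1 (d / r)) _ uC _.
have {}uk : forall k eps, 0 < eps -> exists M, forall i, (M <= i)%N -> `|(u i)`_k| <= eps.
  apply: uk; first by rewrite lt_min ltr01 divr_gt0.
  move=> s eps /andP[ds s0] eps0.
  have s1 : `|s| <= 1.
    rewrite ltr0_norm //; rewrite ltrNl in ds; apply: ltW; apply: lt_le_trans ds _.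
    by rewrite ge_min lexx.
  have [M HM] := uP _ _ s1 eps0; exists M => i /HM; rewrite h0 ?subr0 //.
  have : - s < d / r by rewrite ltrNl in ds; apply: lt_le_trans ds _; rewrite ge_min lexx orbT.
  rewrite ltr_pdivlMr // => sd.
  have : r * s < 0 by rewrite nmulr_llt0.
  lra.
have un := wcauchy_to0 _ uC uk.
exists r => // s sr; pose x := (s - t) / r.
have -> : s = t + r * x by rewrite /x; field; lra.
have x1 : `|x| <= 1 by rewrite normrM normfV (gtr0_norm r0) ler_pdivrMr // mul1r.
apply/eqP; rewrite -normr_le0; apply/ler_addgt0Pr => eps eps0; rewrite add0r.
have e2 : 0 < eps / 2 by rewrite divr_gt0.
have [M1 H1] := uP _ _ x1 e2; have [M2 H2] := un _ e2.
pose i := maxn M1 M2.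
have A1 := H1 i (leq_maxl _ _).
have A2 := le_trans (horner_wnorm (u i) _ x1) (H2 i (leq_maxr _ _)).
set y := h _ in A1 *; have -> : y = (u i).[x] - ((u i).[x] - y) by rewrite subKr.
by apply: le_trans (ler_normB _ _) _; lra.
Qed.

(** The supremum of the [t] such that [h] vanishes on [0, t] can be passed by
    [analytic_at_eq0_left], unless it is 1. *)
Lemma analytic_identity (h : R -> R) d : 0 < d ->
  (forall t, 0 <= t <= 1 -> analytic_at h t) ->
  (forall t, 0 <= t <= d -> h t = 0) -> h 1 = 0.
Proof.
move=> d0 hA h0.
pose E := [set t : R | 0 <= t <= 1 /\ forall s, 0 <= s <= t -> h s = 0].
have E0 : E (Num.min d 1).
  split; first by rewrite le_min ler01 (ltW d0) /= ge_min lexx orbT.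
  by move=> s; rewrite le_min => /and3P[s0 sd _]; apply: h0; rewrite s0 sd.
have Eb : ubound E 1 by move=> t [/andP[]].
have Es : has_sup E by split; [exists (Num.min d 1) | exists 1].
pose t := sup E.
have t0 : 0 < t.
  apply: lt_le_trans (ub_le_sup Es.2 E0); by rewrite lt_min d0 ltr01.
have t1 : t <= 1 by exact: ge_sup Es.1 Eb.
have ht s : 0 <= s < t -> h s = 0.
  move=> /andP[s0 st]; have e0 : 0 < t - s by rewrite subr_gt0.
  have [v [_ Ev] sv] := sup_adherent e0 Es.
  by apply: Ev; rewrite s0 /=; move: sv; rewrite -/t; lra.
have [||d' d'0 hd'] := @analytic_at_eq0_left h t t t0; first by apply: hA; lra.
  by move=> s; rewrite subrr => /andP[s0 st]; apply: ht; rewrite st ltW.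
have E1 : E (Num.min (t + d') 1).
  split; first by rewrite le_min ler01 /= ge_min lexx orbT andbT; lra.
  move=> s /andP[s0]; rewrite le_min => /andP[sd s1].
  have [st|st] := ltP s t; first by apply: ht; rewrite s0.
  by apply: hd'; rewrite ger0_norm ?subr_ge0 //; lra.
have := ub_le_sup Es.2 E1; rewrite -/t.
have [?|?] := leP (t + d') 1; first by lra.
by move=> ?; apply: E1.2; rewrite ler01 /= le_min lexx andbT; lra.
Qed.

End IdentityTheorem.

(** * From power series in n variables to one variable *)

Section PowerSeriesAlongLines.
Context {R : realType} {n : nat}.
Local Notation mindex := {ffun 'I_n -> nat}.

Lemma esum_pickle (a : mindex -> \bar R) :
  (\esum_(i in [set: mindex]) a i =
   \esum_(k in [set: nat]) (if pickle_inv k is Some i then a i else 0))%E.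
Proof.
pose b k := (if pickle_inv k is Some i then a i else 0)%E.
transitivity (\esum_(i in [set: mindex]) b (pickle i))%E.
  by apply: eq_esum => i _; rewrite /b pickleK_inv.
rewrite -(@esum_image R mindex nat setT pickle b); last first.
  by move=> i j _ _; exact: (pcan_inj pickleK).
rewrite esum_mkcond; apply: eq_esum => k _; case: ifPn => // /negP kP.
rewrite /b; case E : (pickle_inv k) => [i|//]; exfalso; apply: kP.
rewrite inE /=; exists i => //; have := @pickle_invK mindex k.
by rewrite E.
Qed.

(** The multi-indices are enumerated through their [pickle] codes; a number that codes no
    multi-index contributes 0. *)
Definition power_series_term (c : mindex -> R) v k : R :=
  if pickle_inv k is Some i then c i * monomial i v else 0.

Lemma power_series_sum_cvg c v (s : R) : power_series_sum c v s ->
  cvgn [normed series (power_series_term c v)] /\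
  series (power_series_term c v) @ \oo --> s.
Proof.
rewrite /power_series_sum; set term := fun i : {ffun 'I_n -> nat} => _.
set x := power_series_term c v => -[sm es].
have TT : (fun k : nat => is_true (xpredT k)) = [set: nat] by apply/seteqP; split.
have smx : summable setT (EFin \o x).
  move: sm; rewrite /summable esum_pickle; congr (_ < _)%E.
  by apply: eq_esum => k _; rewrite /x /power_series_term /=; case: (pickle_inv k) => //; rewrite normr0.
have nc : cvgn [normed series x].
  have := @summable_cvg R xpredT (abse \o (EFin \o x)) (fun i _ => abse_ge0 _).
  have -> : (fun m => \sum_(0 <= k < m) fine ((abse \o (EFin \o x)) k)) = [normed series x].
    by apply/funext => m; rewrite /series /=.
  apply; move: smx; rewrite /summable; congr (_ < _)%E.
  by rewrite TT; apply: eq_esum => k _; rewrite /= normr_id.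
split=> //.
have sc := normed_cvg nc.
suff -> : s = limn (series x) by exact: sc.
apply: EFin_inj; rewrite -EFin_lim // -es !esum_pickle.
have := @summable_eseries_esum R (EFin \o x) xpredT.
rewrite TT => /(_ smx) E; rewrite [RHS](_ : _ = (\sum_(i <oo) (EFin \o x) i)%E); last first.
  by congr (limn _); apply/funext => m; rewrite /series /= sumEFin.
rewrite E; congr (_ - _)%E; apply: eq_esum => k _; rewrite /x /power_series_term.
  rewrite funeposE /=; case: (pickle_inv k) => [a|]; first by rewrite funeposE.
  by symmetry; exact: maxxx.
rewrite funenegE /=; case: (pickle_inv k) => [a|]; first by rewrite funenegE.
by rewrite /= oppr0; symmetry; exact: maxxx.
Qed.

Lemma monomialZ (i : mindex) (t : R) (v : 'rV[R]_n) :
  monomial i (t *: v) = t ^+ (\sum_j i j) * monomial i v.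
Proof.
rewrite /monomial expr_sum -big_split /=; apply: eq_bigr => j _.
by rewrite mxE exprMn.
Qed.

(** On the line through [v] the term of multi-index [i] becomes a multiple of the power of [t] of
    degree \sum_j i j. Its norm is its absolute value at t = 1, so absolute convergence at [v] makes
    the partial sums Cauchy. *)
Lemma power_series_analytic_at (c : mindex -> R) (v : 'rV[R]_n) (h : R -> R) :
  (forall t, `|t| <= 1 -> power_series_sum c (t *: v) (h t)) -> analytic_at h 0.
Proof.
move=> H; have [nc _] : cvgn [normed series (power_series_term c v)] /\ True.
  split=> //; have := H 1; rewrite normr1 scale1r => /(_ (lexx _)).
  by move=> /power_series_sum_cvg[].
pose p k : {poly R} :=
  if pickle_inv k is Some i then (c i * monomial i v) *: 'X^(\sum_j (i : mindex) j) else 0.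
have wp k : wnorm (p k) <= `|power_series_term c v k|.
  rewrite /p /power_series_term; case: (pickle_inv k) => [i|]; last by rewrite wnorm0 normr0.
  rewrite -mul_polyC; apply: le_trans (wnormM _ _) _; rewrite wnormC ler_piMr //.
  elim: (\sum_j _)%N => [|m IH]; first by rewrite expr0 -[1]/(1%:P) wnormC normr1.
  by rewrite exprS (le_trans (wnormM _ _)) // mulr_ile1 ?wnorm_ge0 // -[X in wnorm X]scale1r wnorm_scaleX normr1.
have wsum a b : wnorm (\sum_(a <= k < b) p k) <= \sum_(a <= k < b) `|power_series_term c v k|.
  elim/big_rec2: _ => [|k y1 y2 _ IH]; first by rewrite wnorm0.
  by apply: le_trans (wnormD _ _) _; rewrite lerD.
exists 1, (fun m => \sum_(0 <= k < m) p k); split=> //; split=> [eps eps0|t eps t1 eps0].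
  have /cvgrPdist_le/(_ (eps / 2) (divr_gt0 eps0 (ltr0n R 2))) [M _ HM] := nc.
  have ordered : forall i j, (M <= i)%N -> (i <= j)%N ->
      wnorm (\sum_(0 <= k < i) p k - \sum_(0 <= k < j) p k) <= eps.
    move=> i j Mi ij; rewrite wnorm_sub.
    rewrite (@big_cat_nat _ _ _ i 0%N j) //= addrAC subrr add0r.
    apply: le_trans (wsum _ _) _.
    have := HM i Mi; have := HM j (leq_trans Mi ij); set l := limn _.
    have sE N : [normed series (power_series_term c v)] N = \sum_(0 <= k < N) `|power_series_term c v k| by [].
    rewrite !sE.
    rewrite (@big_cat_nat _ _ _ i 0%N j) //=; set A := \sum_(0 <= k < i) _.
    by set B := \sum_(i <= k < j) _; rewrite !ler_distl; lra.
  exists M => i j Mi Mj; have [ij|/ltnW ij] := leqP i j; first exact: ordered.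
  by rewrite wnorm_sub; exact: ordered.
have [_ sc] := power_series_sum_cvg _ _ _ (H _ t1).
have /cvgrPdist_le/(_ eps eps0) [M _ HM] := sc; exists M => i Mi.
have := HM i Mi; rewrite add0r mul1r distrC; congr (`|_ - _| <= _).
rewrite /series /= horner_sum; apply: eq_bigr => k _.
rewrite /p /power_series_term; case: (pickle_inv k) => [a|]; last by rewrite horner0.
by rewrite monomialZ !hornerE; exact: mulrAC.
Qed.

End PowerSeriesAlongLines.

(** * Order embeddings and facet functionals *)

Section FiniteBounds.
Context {R : realType} {I : finType}.

Lemma finite_pos_lbound (f : I -> R) : (forall i, 0 < f i) ->
  exists2 b, 0 < b & forall i, b <= f i.
Proof.
move=> f0; exists (\big[Num.min/1]_i f i); last first.
  by move=> i; exact: bigmin_le.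
by elim/big_ind: _ => // x y x0 y0; rewrite lt_min x0.
Qed.

Lemma finite_ubound (f : I -> R) : exists2 b, 0 < b & forall i, `|f i| <= b.
Proof.
exists (1 + \sum_i `|f i|); first by rewrite ltr_pwDl // sumr_ge0.
move=> i; rewrite (bigD1 i) //= addrCA lerDl addr_ge0 // sumr_ge0 //.
Qed.

End FiniteBounds.

Section IteratedMaps.
Context {U : Type}.
Implicit Types (f : U -> U).

Lemma iter_fix_mul f k x j : iter k f x = x -> iter (j * k) f x = x.
Proof. by move=> fx; elim: j => // j IH; rewrite mulSn iterD IH. Qed.

Lemma iter_comm f j k x : iter j f (iter k f x) = iter k f (iter j f x).
Proof. by rewrite -!iterD addnC. Qed.

Lemma iter_mul f j k x : iter j (iter k f) x = iter (j * k) f x.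
Proof. by elim: j => // j IH; rewrite mulSn iterD iterS IH. Qed.

Lemma iter_stable f (X : set U) k x : (forall y, X y -> X (f y)) -> X x -> X (iter k f x).
Proof. by move=> fX Xx; elim: k => //= k; exact: fX. Qed.

End IteratedMaps.

Section Facets.
Context {R : realType} {n m : nat} (A : 'M[R]_(m, n)).
Local Notation V := 'rV[R]_n.

Definition facet i (x : V) : R := (x *m A^T) 0 i.

Lemma facetD i x y : facet i (x + y) = facet i x + facet i y.
Proof. by rewrite /facet mulmxDl mxE. Qed.

Lemma facetN i x : facet i (- x) = - facet i x.
Proof. by rewrite /facet mulNmx mxE. Qed.

Lemma facetZ i a x : facet i (a *: x) = a * facet i x.
Proof. by rewrite /facet -scalemxAl mxE. Qed.

Definition facetE := (facetD, facetN, facetZ).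

(** Boxes in the values of the functionals, adapted to the order. They form a base of neighbourhoods
    when the functionals separate points ([nbhs_cubeP]). *)
Definition cube c r : set V := [set z | forall i, facet i c - r < facet i z < facet i c + r].

Definition facet_le (x y : V) := forall i, facet i x <= facet i y.

Lemma cube_center c r : 0 < r -> cube c r c.
Proof. by move=> r0 i; apply/andP; split; lra. Qed.

Lemma cube_sub c r1 r2 : r1 <= r2 -> cube c r1 `<=` cube c r2.
Proof. by move=> r12 z zc i; have /andP[] := zc i => *; apply/andP; split; lra. Qed.

Lemma cube_shift c r1 r2 z : cube c r1 z -> cube z r2 `<=` cube c (r1 + r2).
Proof.
move=> zc y yz i; have /andP[] := zc i; have /andP[] := yz i => *.
by apply/andP; split; lra.
Qed.

Lemma cube_open c r x : cube c r x -> exists2 b, 0 < b & cube x b `<=` cube c r.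
Proof.
move=> xc; have [|b b0 Hb] := finite_pos_lbound
  (fun i => Num.min (facet i c + r - facet i x) (facet i x - (facet i c - r))).
  by move=> i; have /andP[? ?] := xc i; rewrite lt_min; apply/andP; split; lra.
exists b => // y xy i; have := Hb i; rewrite le_min => /andP[? ?].
by have /andP[? ?] := xy i; apply/andP; split; lra.
Qed.

Definition dense_in_cube (P : set V) c r :=
  forall z eps, cube c r z -> 0 < eps -> exists p, P p /\ cube z eps p.

Context (e : V) (he : forall i, 0 < facet i e).
Context (u : 'I_m -> V) (u0 : forall i, facet i (u i) = 0)
  (u1 : forall i l, l != i -> 0 < facet l (u i)).

(* The pairs (x - tau u_i, y + tau u_i) with phi_i y < phi_i x form the       *)
(* "standard example" of order dimension m. An order embedding maps it to     *)
(* another one, which a family of m linear preorders can only accommodate if  *)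
(* each of them reverses exactly one of the pairs.                            *)
Lemma facet_permutation c r : 0 < r -> exists2 eta, 0 < eta <= r &
  forall (P : set V) (G : V -> V), dense_in_cube P c r ->
    (forall x y, P x -> P y -> cube c r x -> cube c r y ->
       facet_le x y <-> facet_le (G x) (G y)) ->
  exists s : {perm 'I_m}, forall i x y, P x -> P y ->
    cube c eta x -> cube c eta y -> facet i y < facet i x ->
    facet (s i) (G y) < facet (s i) (G x).
Proof.
move=> r0; have [Me Me0 HMe] := finite_ubound (fun i => facet i e).
have [Mu Mu0 HMu] := finite_ubound (fun p : 'I_m * 'I_m => facet p.1 (u p.2)).
have [be be0 Hbe] := finite_pos_lbound _ he.
have [bu bu0 Hbu] : exists2 b, 0 < b & forall i j l, i != j -> b <= facet l (u i) + facet l (u j).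
  have [|b b0 Hb] := finite_pos_lbound (fun p : 'I_m * 'I_m * 'I_m =>
     if p.1.1 == p.1.2 then 1 else facet p.2 (u p.1.1) + facet p.2 (u p.1.2)).
    move=> [[i j] l] /=; case: eqVneq => // ij.
    have [->|li] := eqVneq l i; first by rewrite u0 add0r u1.
    have [->|lj] := eqVneq l j; first by rewrite u0 addr0 u1 // eq_sym.
    by rewrite addr_gt0 // u1.
  exists b => // i j l ij; have := Hb (i, j, l).
  by rewrite /= (negbTE ij).
have {}HMe i : facet i e <= Me by apply: le_trans (HMe i); exact: ler_norm.
have {}HMu i l : 0 <= facet l (u i) <= Mu.
  rewrite (le_trans _ (HMu (l, i))) ?ler_norm // andbT.
  by have [->|li] := eqVneq l i; rewrite ?u0 // ltW // u1.
(* A shift by [tau *: u i] changes each functional by at most r / 4, hence stays inside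
   [cube c r]. *)
pose tau := r / (4 * Mu).
have tau0 : 0 < tau by rewrite divr_gt0 // mulr_gt0.
have tauM i l : 0 <= tau * facet l (u i) <= r / 4.
  have /andP[a0 a1] := HMu i l; rewrite mulr_ge0 ?(ltW tau0) //=.
  rewrite /tau mulrAC ler_pdivrMr ?mulr_gt0 //.
  have -> : r / 4 * (4 * Mu) = r * Mu by field.
  by rewrite ler_wpM2l // ltW.
(* Two points of [cube c eta] differ by less than 2 * eta in each functional; the second bound lets
   the shifts along two distinct [u i], [u j] outweigh this. *)
pose eta := Num.min (r / 8) (tau * bu / 2).
have eta0 : 0 < eta by rewrite lt_min !divr_gt0 // mulr_gt0.
have eta1 : eta <= r / 8 by rewrite ge_min lexx.
have eta2 : eta * 2 <= tau * bu by rewrite -ler_pdivlMr // ge_min lexx orbT.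
exists eta; first by rewrite eta0 /=; lra.
move=> P G Pd GP.
(* The i-th pair of the standard example, realized by points of [P]: [a] lies below a shifted [x],
   [b] above a shifted [y], and functional [i] still reverses them. *)
pose E i a b := [/\ P a, P b, cube c r a, cube c r b & facet i b < facet i a /\
  exists x y, [/\ cube c eta x, cube c eta y,
    forall l, facet l a <= facet l x - tau * facet l (u i) &
    forall l, facet l y + tau * facet l (u i) <= facet l b]].
have Eex i x y : cube c eta x -> cube c eta y -> facet i y < facet i x ->
    exists a b, [/\ E i a b, facet_le a x & facet_le y b].
  move=> xc yc yx; pose d := facet i x - facet i y.
  have d0 : 0 < d by rewrite subr_gt0.
  (* The extra push along [e] leaves room for replacing the shifted points by points of [P]; it is
     small against the gap [d], so functional [i] stays reversed. *)
  pose kap := Num.min (r / (4 * Me)) (d / (8 * Me)).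
  have kap0 : 0 < kap by rewrite lt_min !divr_gt0 // mulr_gt0.
  have kap1 l : 0 < kap * facet l e <= r / 4.
    rewrite mulr_gt0 //=; apply: (@le_trans _ _ (kap * Me)).
      by rewrite ler_wpM2l // ltW.
    rewrite -ler_pdivlMr // (_ : r / 4 / Me = r / (4 * Me)) ?ge_min ?lexx //.
    by rewrite invfM mulrA.
  have kap2 : kap * facet i e <= d / 8.
    apply: (@le_trans _ _ (kap * Me)); first by rewrite ler_wpM2l // ltW.
    rewrite -ler_pdivlMr // (_ : d / 8 / Me = d / (8 * Me)) ?ge_min ?lexx ?orbT //.
    by rewrite invfM mulrA.
  pose eps := Num.min (kap * be) (Num.min (d / 8) (r / 8)).
  have eps0 : 0 < eps by rewrite !lt_min mulr_gt0 // !divr_gt0.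
  have eps1 l : eps <= kap * facet l e.
    apply: (@le_trans _ _ (kap * be)); first by rewrite ge_min lexx.
    by rewrite ler_wpM2l // ltW.
  have eps2 : eps <= d / 8 by rewrite !ge_min lexx !orbT.
  have eps3 : eps <= r / 8 by rewrite !ge_min lexx !orbT.
  have [|a [Pa ha]] := Pd (x - tau *: u i - kap *: e) eps _ eps0.
    move=> l; rewrite !facetE; have /andP[] := xc l; have /andP[] := tauM i l.
    by have /andP[] := kap1 l => *; apply/andP; split; lra.
  have [|b [Pb hb]] := Pd (y + tau *: u i + kap *: e) eps _ eps0.
    move=> l; rewrite !facetE; have /andP[] := yc l; have /andP[] := tauM i l.
    by have /andP[] := kap1 l => *; apply/andP; split; lra.
  have ax l : facet l a <= facet l x - tau * facet l (u i).
    by have := ha l; rewrite !facetE => /andP[_]; have := eps1 l; lra.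
  have yb l : facet l y + tau * facet l (u i) <= facet l b.
    by have := hb l; rewrite !facetE => /andP[+ _]; have := eps1 l; lra.
  exists a, b; split; last 2 first.
  - by move=> l; apply: le_trans (ax l) _; have /andP[] := tauM i l; lra.
  - by move=> l; apply: le_trans (yb l); have /andP[] := tauM i l; lra.
  split=> //.
  - move=> l; have := ha l; rewrite !facetE; have /andP[] := xc l.
    have /andP[] := tauM i l; have /andP[] := kap1 l => ? ? ? ? ? ? /andP[? ?].
    by apply/andP; split; lra.
  - move=> l; have := hb l; rewrite !facetE; have /andP[] := yc l.
    have /andP[] := tauM i l; have /andP[] := kap1 l => ? ? ? ? ? ? /andP[? ?].
    by apply/andP; split; lra.
  split; last by exists x, y.
  have := ha i; have := hb i; rewrite !facetE u0 => /andP[_ ?] /andP[? _].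
  by rewrite /d in d0 kap2 eps2; lra.
have Ecross i j a b a' b' : i != j -> E i a b -> E j a' b' -> facet_le a b'.
  move=> ij [_ _ _ _ [_ [x [_ [xc _ ax _]]]]] [_ _ _ _ [_ [_ [y [_ yc _ yb]]]]] l.
  have := ax l; have := yb l; have /andP[] := xc l; have /andP[] := yc l.
  have := ler_wpM2l (ltW tau0) (Hbu _ _ l ij); rewrite mulrDr; lra.
have Erev i a b : E i a b -> exists l, facet l (G b) < facet l (G a).
  move=> [Pa Pb ca cb [ba _]]; apply: contrapT => nl.
  have /(GP _ _ Pa Pb ca cb).2 : facet_le (G a) (G b).
    by move=> l; rewrite leNgt; apply/negP => ?; apply: nl; exists l.
  by move=> /(_ i); rewrite leNgt ba.
(* One functional cannot reverse pairs of two different indices: with the cross comparisons given by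
   [Ecross] this would close a strict cycle. *)
have Einj i j a b a' b' l : E i a b -> E j a' b' -> facet l (G b) < facet l (G a) ->
    facet l (G b') < facet l (G a') -> i = j.
  move=> Eab Eab' ba ba'; apply/eqP; apply/negPn/negP => ij.
  have [Pa Pb ca cb _] := Eab; have [Pa' Pb' ca' cb' _] := Eab'.
  have := (GP _ _ Pa Pb' ca cb').1 (Ecross _ _ _ _ _ _ ij Eab Eab') l.
  rewrite eq_sym in ij.
  have := (GP _ _ Pa' Pb ca' cb).1 (Ecross _ _ _ _ _ _ ij Eab' Eab) l.
  by move=> h1 h2; have := lt_trans (le_lt_trans h2 ba') (le_lt_trans h1 ba); rewrite ltxx.
have /choice [s0 Hs0] i : exists l, exists a b, E i a b /\ facet l (G b) < facet l (G a).
  have [|||a [b [Eab _ _]]] := Eex i (c + (eta / (2 * Me)) *: e) c.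
  - have p0 : 0 < eta / (2 * Me) by rewrite divr_gt0 // mulr_gt0.
    move=> l; rewrite !facetE; have := mulr_gt0 p0 (he l).
    have : eta / (2 * Me) * facet l e <= eta / 2.
      apply: (@le_trans _ _ (eta / (2 * Me) * Me)); first by rewrite ler_wpM2l // ltW.
      by rewrite invfM mulrA divfK // gt_eqF.
    by move=> *; apply/andP; split; lra.
  - exact: cube_center.
  - by rewrite !facetE ltrDl mulr_gt0 // divr_gt0 // mulr_gt0.
  by have [l hl] := Erev _ _ _ Eab; exists l, a, b.
have s0_inj : injective s0.
  move=> i j s0ij; have [a [b [Eab ab]]] := Hs0 i; have [a' [b' [Eab' ab']]] := Hs0 j.
  by rewrite -s0ij in ab'; exact: Einj Eab Eab' ab ab'.
exists (perm s0_inj) => i x y Px Py cx cy yx; rewrite permE.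
have [a [b [Eab ax yb]]] := Eex _ _ _ cx cy yx.
have [l lab] := Erev _ _ _ Eab.
(* An injective self-map of a finite set is onto, so [l] is a value of [s0], and [Einj] tells at
   which index. *)
have sur : s0 i = l.
  have -> : l = s0 ((perm s0_inj)^-1%g l) by rewrite -[RHS](permE s0_inj) permKV.
  congr s0; have [a' [b' [Eab' ab']]] := Hs0 ((perm s0_inj)^-1%g l).
  rewrite -[s0 _](permE s0_inj) permKV in ab'.
  exact: Einj Eab Eab' lab ab'.
have er : eta <= r by lra.
have [Pa Pb ca cb _] := Eab; rewrite sur.
have Gax := (GP _ _ Pa Px ca (cube_sub _ _ _ er _ cx)).1 ax l.
have Gyb := (GP _ _ Py Pb (cube_sub _ _ _ er _ cy) cb).1 yb l.
exact: le_lt_trans Gyb (lt_le_trans lab Gax).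
Qed.

Context (facet_inj : forall x, (forall i, facet i x = 0) -> x = 0).

Lemma facet_eq x y : (forall i, facet i x = facet i y) -> x = y.
Proof.
move=> xy; apply/subr0_eq/facet_inj => i.
by rewrite !facetE xy subrr.
Qed.

Context (X : set V) (F : V -> V) (FX : forall x, X x -> X (F x)).
Context (Fmono : forall x y, X x -> X y -> facet_le x y -> facet_le (F x) (F y)).

Lemma iter_mono k x y : X x -> X y -> facet_le x y ->
  facet_le (iter k F x) (iter k F y).
Proof.
move=> Xx Xy xy; elim: k => //= k IH.
by apply: Fmono => //; exact: iter_stable.
Qed.

Definition periodic_in : set V := [set x | X x /\ exists2 k, (0 < k)%N & iter k F x = x].

Lemma periodic_in_stable k x : periodic_in x -> periodic_in (iter k F x).
Proof.
move=> [Xx [j j0 jx]]; split; first exact: iter_stable.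
by exists j => //; rewrite iter_comm jx.
Qed.

(** Further monotone iteration brings both points back to themselves, so an inequality between
    images implies one between the points. *)
Lemma periodic_order_embedding k x y : periodic_in x -> periodic_in y ->
  facet_le x y <-> facet_le (iter k F x) (iter k F y).
Proof.
move=> [Xx [kx kx0 hx]] [Xy [ky ky0 hy]]; split; first exact: iter_mono.
move=> /(iter_mono (kx * ky * k - k)%N).
have kk : (k <= kx * ky * k)%N by rewrite leq_pmull // muln_gt0 kx0.
have ex : iter (kx * ky * k) F x = x.
  by rewrite -mulnA mulnC iter_fix_mul.
have ey : iter (kx * ky * k) F y = y.
  by rewrite mulnAC iter_fix_mul.
by rewrite -!iterD subnK // ex ey; apply; exact: iter_stable.
Qed.

End Facets.

(** * A common period and the product form on a cube *)

Section MonotoneMaps.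
Context {R : realType} {n m : nat} (A : 'M[R]_(m, n)).
Local Notation V := 'rV[R]_n.
Local Notation facet := (facet A).
Local Notation cube := (cube A).
Local Notation facet_le := (facet_le A).
Context (e : V) (he : forall i, 0 < facet i e).
Context (u : 'I_m -> V) (u0 : forall i, facet i (u i) = 0)
  (u1 : forall i l, l != i -> 0 < facet l (u i)).
Context (facet_inj : forall x, (forall i, facet i x = 0) -> x = 0).
Context (X : set V) (F : V -> V) (FX : forall x, X x -> X (F x)).
Context (Fmono : forall x y, X x -> X y -> facet_le x y -> facet_le (F x) (F y)).
Local Notation periodic_in := (periodic_in X F).

(** Two periodic points on either side of [c] bound an order interval, invariant under any iterate
    that fixes both. There the permutation of the functionals has finite order, so a further iterate
    is strictly increasing in each functional. *)
Lemma periodic_on_cube c r : 0 < r -> cube c r `<=` X ->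
  dense_in_cube A periodic_in c r ->
  exists N c' r', [/\ (0 < N)%N, 0 < r', cube c' r' `<=` cube c r &
    forall x, periodic_in x -> cube c' r' x -> iter N F x = x].
Proof.
move=> r0 cX Pd; have [eta /andP[eta0 etar] Heta] := facet_permutation A e he u u0 u1 c r r0.
have [Me Me0 HMe] := finite_ubound (fun i => facet i e).
have [be be0 Hbe] := finite_pos_lbound _ he.
have {}HMe i : facet i e <= Me by apply: le_trans (HMe i); exact: ler_norm.
pose t := eta / (4 * Me); have t0 : 0 < t by rewrite divr_gt0 // mulr_gt0.
have t1 l : t * be <= t * facet l e <= eta / 4.
  rewrite ler_wpM2l ?(ltW t0) //=; apply: (@le_trans _ _ (t * Me)).
    by rewrite ler_wpM2l // ltW.
  by rewrite /t invfM mulrA mulfVK // gt_eqF.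
have tb0 : 0 < t * be by rewrite mulr_gt0.
pose eps := Num.min (t * be / 2) (eta / 4).
have eps0 : 0 < eps by rewrite lt_min !divr_gt0.
have eps1 : eps <= t * be / 2 by rewrite ge_min lexx.
have eps2 : eps <= eta / 4 by rewrite ge_min lexx orbT.
have [|p [Pp hp]] := Pd (c - t *: e) eps _ eps0.
  by move=> l; rewrite !facetE; have /andP[? ?] := t1 l; apply/andP; split; lra.
have [|q [Pq hq]] := Pd (c + t *: e) eps _ eps0.
  by move=> l; rewrite !facetE; have /andP[? ?] := t1 l; apply/andP; split; lra.
pose I := [set z | facet_le p z /\ facet_le z q].
have Ic : I `<=` cube c eta.
  move=> z [pz zq] l; have := pz l; have := zq l; have := hp l; have := hq l.
  rewrite !facetE; have /andP[? ?] := t1 l => /andP[? ?] /andP[? ?] ? ?.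
  by apply/andP; split; lra.
have cI : cube c (t * be / 2) `<=` I.
  move=> z zc; split=> l; have /andP[] := zc l; have := hp l; have := hq l.
    by rewrite !facetE; have /andP[? ?] := t1 l => /andP[? ?] /andP[? ?] ? ?; lra.
  by rewrite !facetE; have /andP[? ?] := t1 l => /andP[? ?] /andP[? ?] ? ?; lra.
have Icr : I `<=` cube c r by move=> z /Ic /(cube_sub A c _ _ etar).
have IX z : I z -> X z by move=> /Icr /cX.
have [[Xp [kp kp0 hkp]] [Xq [kq kq0 hkq]]] := (Pp, Pq).
pose S := iter (kp * kq) F.
have Sp : S p = p by rewrite /S mulnC iter_fix_mul.
have Sq : S q = q by rewrite /S iter_fix_mul.
have SI z : I z -> I (S z).
  move=> Iz; have [pz zq] := Iz; have Xz := IX z Iz.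
  split.
    have := iter_mono A X F FX Fmono (kp * kq)%N p z Xp Xz pz.
    by rewrite -[iter _ F p]/(S p) Sp.
  have := iter_mono A X F FX Fmono (kp * kq)%N z q Xz Xq zq.
  by rewrite -[iter _ F q]/(S q) Sq.
have SP z : periodic_in z -> periodic_in (S z) by exact: periodic_in_stable.
have [s Hs] : exists s : {perm 'I_m}, forall i x y, periodic_in x -> periodic_in y ->
    cube c eta x -> cube c eta y -> facet i y < facet i x ->
    facet (s i) (S y) < facet (s i) (S x).
  apply: Heta => // x y Px Py _ _.
  exact: (periodic_order_embedding A X F FX Fmono).
have HSj j i x y : I x -> I y -> periodic_in x -> periodic_in y ->
    facet i y < facet i x ->
    facet ((s ^+ j)%g i) (iter j S y) < facet ((s ^+ j)%g i) (iter j S x).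
  move=> Ix Iy Px Py yx; elim: j => [|j IH]; first by rewrite expg0 perm1.
  rewrite expgSr permM !iterS; apply: Hs => //.
  - by apply: iter_stable.
  - by apply: iter_stable.
  - by apply: Ic; apply: iter_stable.
  - by apply: Ic; apply: iter_stable.
pose Q := iter #[s]%g S.
have QI z : I z -> I (Q z) by exact: iter_stable.
have QP z : periodic_in z -> periodic_in (Q z) by exact: iter_stable.
have HQ i x y : I x -> I y -> periodic_in x -> periodic_in y ->
    facet i y < facet i x -> facet i (Q y) < facet i (Q x).
  by move=> Ix Iy Px Py /(HSj #[s]%g _ _ _ Ix Iy Px Py); rewrite expg_order perm1.
have HQj j i x y : I x -> I y -> periodic_in x -> periodic_in y ->
    facet i y < facet i x -> facet i (iter j Q y) < facet i (iter j Q x).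
  move=> Ix Iy Px Py yx; elim: j => [|j IH] //; rewrite !iterS; apply: HQ => //;
  by apply: iter_stable.
have QE x j : iter j Q x = iter (j * (#[s]%g * (kp * kq))) F x.
  by rewrite -iter_mul; apply: eq_iter => z; rewrite /Q /S iter_mul.
exists (#[s]%g * (kp * kq))%N, c, (t * be / 2); split.
- by rewrite !muln_gt0 order_gt0 kp0 kq0.
- by rewrite divr_gt0.
- by move=> z /cI /Icr.
move=> x Px /cI Ix.
have -> : iter (#[s]%g * (kp * kq)) F x = Q x by rewrite -[Q x]/(iter 1 Q x) QE mul1n.
apply: (facet_eq A facet_inj) => i.
have [Xx [k k0 kx]] := Px.
have kQ : iter k Q x = x by rewrite QE mulnC iter_fix_mul.
(* If [Q] moved [x] in functional [i], that functional would be strictly monotone along the orbit,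
   which nevertheless returns to [x]. *)
case: (ltgtP (facet i (Q x)) (facet i x)) => // h; exfalso.
  have chain j : facet i (iter j.+1 Q x) < facet i x.
    elim: j => [|j IH] //; apply: lt_trans IH.
    by rewrite iterSr; exact: (HQj _ _ _ _ Ix (QI _ Ix) Px (QP _ Px) h).
  by have := chain k.-1; rewrite prednK // kQ ltxx.
have chain j : facet i x < facet i (iter j.+1 Q x).
  elim: j => [|j IH] //; apply: lt_trans IH _.
  by rewrite [X in _ < facet i X]iterSr; exact: (HQj _ _ _ _ (QI _ Ix) Ix (QP _ Px) Px h).
by have := chain k.-1; rewrite prednK // kQ ltxx.
Qed.

Definition continuous_in_cubes (G : V -> V) x := forall eps, 0 < eps ->
  exists2 d, 0 < d & forall z, cube x d z -> cube (G x) eps (G z).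

(** As F^N = id on the cube, [F] reflects the order there, and [facet_permutation] applies with the
    whole cube as dense set. *)
Lemma local_product c r N : 0 < r -> cube c r `<=` X -> (0 < N)%N ->
  (forall x, cube c r x -> iter N F x = x) ->
  (forall x, cube c r x -> continuous_in_cubes F x) ->
  exists (s : {perm 'I_m}) eta, 0 < eta <= r /\
    forall i x y, cube c eta x -> cube c eta y ->
    (facet i y < facet i x -> facet (s i) (F y) < facet (s i) (F x)) /\
    (facet i y = facet i x -> facet (s i) (F y) = facet (s i) (F x)).
Proof.
move=> r0 cX N0 FN Fc; have [eta etar Heta] := facet_permutation A e he u u0 u1 c r r0.
have [eta0 eta1] := andP etar.
have [|x y cx cy _ _|s Hs] := Heta (cube c r) F.
- by move=> z eps cz eps0; exists z; split=> //; exact: cube_center.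
- have [Xx Xy] := (cX _ cx, cX _ cy); split; first exact: Fmono.
  move=> /(iter_mono A X F FX Fmono N.-1 _ _ (FX _ Xx) (FX _ Xy)).
  by rewrite -!iterSr prednK // !FN.
have sub := cube_sub A c _ _ eta1.
have {}Hs i x y (cx : cube c eta x) (cy : cube c eta y) := Hs i x y (sub _ cx) (sub _ cy) cx cy.
(* The strict statement is applied to [y] and [x + t *: e], and continuity at [x] lets [t] tend to
   0. *)
have half i x y : cube c eta x -> cube c eta y -> facet i y = facet i x ->
    facet (s i) (F y) <= facet (s i) (F x).
  move=> cx cy yx; apply/ler_addgt0Pr => eps eps0.
  have [d d0 Hd] := Fc x (sub _ cx) _ eps0.
  have [Me Me0 HMe] := finite_ubound (fun i => facet i e).
  have {}HMe l : facet l e <= Me by apply: le_trans (HMe l); exact: ler_norm.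
  have [|b b0 Hb] := finite_pos_lbound (fun l => facet l c + eta - facet l x).
    by move=> l; have /andP[] := cx l; lra.
  have {}Hb l : facet l x + b <= facet l c + eta by have := Hb l; lra.
  pose t := Num.min d b / (2 * Me).
  have db0 : 0 < Num.min d b by rewrite lt_min d0.
  have t0 : 0 < t by rewrite divr_gt0 // mulr_gt0.
  have tM l : 0 < t * facet l e < Num.min d b.
    rewrite mulr_gt0 //=; apply: (@le_lt_trans _ _ (t * Me)).
      by rewrite ler_wpM2l // ltW.
    by rewrite /t invfM mulrA divfK ?gt_eqF //; lra.
  have td l : t * facet l e < d by have /andP[_] := tM l; rewrite lt_min => /andP[].
  have tb l : t * facet l e < b by have /andP[_] := tM l; rewrite lt_min => /andP[].
  have tp l : 0 < t * facet l e by have /andP[] := tM l.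
  have /Hd /(_ (s i)) : cube x d (x + t *: e).
    by move=> l; rewrite !facetE; have := td l; have := tp l => *; apply/andP; split; lra.
  have : facet (s i) (F y) < facet (s i) (F (x + t *: e)).
    apply: Hs => //; last by rewrite !facetE yx ltrDl.
    move=> l; rewrite !facetE; have := tb l; have := tp l; have := Hb l.
    by have /andP[] := cx l => *; apply/andP; split; lra.
  by move=> h1 /andP[h2 h3]; lra.
exists s, eta; split=> // i x y cx cy; split; first exact: Hs.
by move=> yx; apply: le_anti; rewrite !half.
Qed.

End MonotoneMaps.

Section AnalyticAtExtra.
Context {R : realType}.

Lemma analytic_atN (h : R -> R) t : analytic_at h t -> analytic_at (fun s => - h s) t.
Proof.
move=> hA; have := analytic_at_comp (fun s => 0 + (-1) * s) h t hA.
move=> /(_ (analytic_at_affine _ _ _)); congr (analytic_at _ _).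
by apply/funext => s /=; rewrite add0r mulN1r.
Qed.

Lemma analytic_atB (h1 h2 : R -> R) t :
  analytic_at h1 t -> analytic_at h2 t -> analytic_at (fun s => h1 s - h2 s) t.
Proof. by move=> A1 A2; apply: analytic_atD => //; exact: analytic_atN. Qed.

Lemma analytic_at_shift (h : R -> R) t :
  analytic_at (fun s => h (t + s)) 0 -> analytic_at h t.
Proof.
move=> [r [p [r0 hp]]]; exists r, p; split=> //; move: hp; congr (wlimit _ _).
by apply/funext => s; rewrite add0r.
Qed.

Lemma analytic_atZ (h : R -> R) a t : analytic_at h t -> analytic_at (fun s => a * h s) t.
Proof.
move=> hA; have := analytic_at_comp (fun s => 0 + a * s) h t hA.
move=> /(_ (analytic_at_affine _ _ _)); congr (analytic_at _ _).
by apply/funext => s /=; rewrite add0r.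
Qed.

Lemma analytic_at_sum n (h : 'I_n -> R -> R) t :
  (forall i, analytic_at (h i) t) -> analytic_at (fun s => \sum_i h i s) t.
Proof.
elim: n h => [|n IH] h hA.
  have := analytic_at_affine 0 0 t; congr (analytic_at _ _).
  by apply/funext => s; rewrite big_ord0 mul0r addr0.
have -> : (fun s => \sum_i h i s) = (fun s => h ord0 s + \sum_i h (lift ord0 i) s).
  by apply/funext => s; rewrite big_ord_recl.
by apply: analytic_atD => //; apply: IH.
Qed.

End AnalyticAtExtra.

Section FacetBases.
Context {R : realType} {n m : nat} (A : 'M[R]_(m, n)).
Local Notation V := 'rV[R]_n.
Local Notation phi := (facet A).

Lemma facet_rowsub (f : 'I_n -> 'I_m) j x :
  phi (f j) x = (x *m (rowsub f A)^T) 0 j.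
Proof. by rewrite /facet [LHS]mxE [RHS]mxE; apply: eq_bigr => k _; rewrite !mxE. Qed.

Lemma facet_sum i (I : finType) (a : I -> V) :
  phi i (\sum_j a j) = \sum_j phi i (a j).
Proof. by rewrite /facet mulmx_suml summxE. Qed.

Definition facet_dual (f : 'I_n -> 'I_m) (d : 'I_n -> V) :=
  (forall i j, phi (f j) (d i) = (i == j)%:R) /\
  (forall x, (forall j, phi (f j) x = 0) -> x = 0).

Lemma facet_dual_exists f : rowsub f A \in unitmx -> exists d, facet_dual f d.
Proof.
move=> fA; have fA' : (rowsub f A)^T \in unitmx by rewrite unitmx_tr.
exists (fun i => delta_mx 0 i *m invmx (rowsub f A)^T); split=> [i j|x x0].
  by rewrite facet_rowsub mulmxKV // mxE eqxx eq_sym.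
rewrite -[x](mulmxK fA'); apply/eqP.
suff -> : x *m (rowsub f A)^T = 0 by rewrite mul0mx.
by apply/rowP => j; rewrite -facet_rowsub x0 mxE.
Qed.

Lemma facet_dependence f : rowsub f A \notin unitmx ->
  exists a : 'I_n -> R, (exists i, a i != 0) /\
    forall x, \sum_j a j * phi (f j) x = 0.
Proof.
rewrite -row_free_unit -kermx_eq0 => /rowV0Pn[v].
rewrite sub_kermx => /eqP vA v0; exists (v 0); split; first exact/rV0Pn.
move=> x; have : (v *m rowsub f A *m x^T) 0 0 = 0 by rewrite vA mul0mx mxE.
rewrite -mulmxA mxE => E; rewrite -[RHS]E; apply: eq_bigr => j _; congr (_ * _).
rewrite facet_rowsub [LHS]mxE [RHS]mxE; apply: eq_bigr => k _.
by rewrite !mxE mulrC.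
Qed.

Lemma facet_basis : (forall x, (forall i, phi i x = 0) -> x = 0) ->
  exists f, rowsub f A \in unitmx.
Proof.
move=> inj.
have fA : row_full A.
  rewrite /row_full -mxrank_tr -/(row_free _) -kermx_eq0; apply/rowV0P => v.
  rewrite sub_kermx => /eqP vA; apply: inj => i.
  by rewrite /facet vA mxE.
by exists (fullrankfun fA); exact: fullrowsub_unit.
Qed.

End FacetBases.

(** * Analytic continuation *)

Section AnalyticContinuation.
Context {R : realType} {n m : nat} (A : 'M[R]_(m, n)).
Local Notation V := 'rV[R]_n.
Local Notation facet := (facet A).
Local Notation cube := (cube A).
Local Notation facet_le := (facet_le A).
Context (e : V) (he : forall i, 0 < facet i e).
Context (facet_inj : forall x, (forall i, facet i x = 0) -> x = 0).
Context (X : set V) (F : V -> V) (FX : forall x, X x -> X (F x)).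
Context (Fmono : forall x y, X x -> X y -> facet_le x y -> facet_le (F x) (F y)).
Context (Finj : forall x y, X x -> X y -> F x = F y -> x = y).

Definition cube_interior : set V := [set x | exists2 r, 0 < r & cube x r `<=` X].

Context (Fcont : forall k x, cube_interior x -> continuous_in_cubes A (iter k F) x).
Context (Fan : forall i x v, cube_interior x ->
  analytic_at (fun t => facet i (F (x + t *: v))) 0).
Context (Xconn : forall Q : set V, (exists x, cube_interior x /\ Q x) ->
  (forall x, cube_interior x -> Q x -> exists2 r, 0 < r & cube x r `<=` Q) ->
  (forall x, cube_interior x -> (forall r, 0 < r -> exists y, cube x r y /\ Q y) -> Q x) ->
  cube_interior `<=` Q).

(** Near [x], [F] is a product of one-variable maps in the facet coordinates, up to the relabelling
    [s]. *)
Definition product_at (s : 'I_m -> 'I_m) x := exists2 r, 0 < r &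
  forall z z' i, cube x r z -> cube x r z' -> facet i z = facet i z' ->
    facet (s i) (F z) = facet (s i) (F z').

Lemma cube_half_interior c r : 0 < r -> cube c r `<=` X -> cube c (r / 2) `<=` cube_interior.
Proof.
move=> r0 cX z zc; exists (r / 2); first by rewrite divr_gt0.
by move=> y /(cube_shift A _ _ _ _ zc); rewrite -splitr => /cX.
Qed.

Lemma cube_convex c r x y t : 0 <= t <= 1 -> cube c r x -> cube c r y ->
  cube c r (x + t *: (y - x)).
Proof.
move=> /andP[t0 t1] xc yc i; rewrite !facetE.
have /andP[xa xa'] := xc i; have /andP[yb yb'] := yc i.
have -> : facet i x + t * (facet i y - facet i x) = (1 - t) * facet i x + t * facet i y by ring.
set a := facet i x in xa xa' *; set b := facet i y in yb yb' *.
have conv L p q : L < p -> L < q -> L < (1 - t) * p + t * q.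
  move=> Lp Lq; have : 0 <= (1 - t) * (p - L) by rewrite mulr_ge0 // subr_ge0 // ltW.
  have [->|tn0] := eqVneq t 0; first lra.
  have : 0 < t * (q - L) by rewrite mulr_gt0 ?subr_gt0 // lt_neqAle eq_sym tn0.
  lra.
apply/andP; split; first exact: conv.
rewrite -ltrN2; have := conv (- (facet i c + r)) (- a) (- b).
by rewrite !ltrN2 => /(_ xa' yb'); lra.
Qed.

Lemma cube_ray x v r : 0 < r -> exists2 d, 0 < d &
  forall t, `|t| <= d -> cube x r (x + t *: v).
Proof.
move=> r0; have [M M0 HM] := finite_ubound (fun i => facet i v).
exists (r / (2 * M)); first by rewrite divr_gt0 // mulr_gt0.
move=> t td i; rewrite !facetE.
have : `|t * facet i v| < r.
  rewrite normrM; apply: (@le_lt_trans _ _ (r / (2 * M) * M)).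
    exact: ler_pM.
  by rewrite invfM mulrA divfK ?gt_eqF //; lra.
by rewrite ltr_norml => /andP[? ?]; apply/andP; split; lra.
Qed.

(** If [z] and [z'] agree in functional [i], so do points at equal times on the segments to them
    from a point [y] where the product form holds. The identity theorem carries the equality of the
    images from [y] to the ends. *)
Lemma product_propagates s : (exists x, cube_interior x /\ product_at s x) ->
  cube_interior `<=` product_at s.
Proof.
move=> ex; apply: Xconn => // x Xx => [[r r0 Hr]|near_x].
  exists (r / 2); first by rewrite divr_gt0.
  move=> y xy; exists (r / 2); first by rewrite divr_gt0.
  by move=> z z' i /(cube_shift A _ _ _ _ xy) + /(cube_shift A _ _ _ _ xy); rewrite -splitr; exact: Hr.
have [r r0 cX] := Xx; have r20 : 0 < r / 2 by rewrite divr_gt0.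
have cI := cube_half_interior x r r0 cX.
have [y [xy [rho rho0 Hy]]] := near_x _ r20.
exists (r / 2) => // z z' i xz xz' zz'.
have [d1 d10 Hd1] := cube_ray y (z - y) rho rho0.
have [d2 d20 Hd2] := cube_ray y (z' - y) rho rho0.
have seg w t : cube x (r / 2) w -> 0 <= t <= 1 -> cube_interior (y + t *: (w - y)).
  by move=> xw t01; apply: cI; exact: cube_convex.
have an w t : cube x (r / 2) w -> 0 <= t <= 1 ->
    analytic_at (fun t => facet (s i) (F (y + t *: (w - y)))) t.
  move=> xw t01; apply: analytic_at_shift.
  have := Fan (s i) _ (w - y) (seg _ _ xw t01); congr (analytic_at _ _).
  by apply/funext => a; rewrite scalerDl addrA.
have /= := analytic_identity (fun t => facet (s i) (F (y + t *: (z - y))) -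
  facet (s i) (F (y + t *: (z' - y)))) (Num.min d1 d2).
rewrite !scale1r ![y + (_ - y)]addrC !subrK => H; apply/subr0_eq/H.
- by rewrite lt_min d10.
- by move=> t t01; apply: analytic_atB; exact: an.
- move=> t /andP[t0]; rewrite le_min => /andP[td1 td2]; apply/eqP; rewrite subr_eq0; apply/eqP.
  apply: Hy; [apply: Hd1|apply: Hd2|]; rewrite ?ger0_norm //.
  by rewrite !facetE zz'.
Qed.

(* In coordinates F is a product of continuous injective functions of one     *)
(* variable, so that the intermediate value theorem replaces invariance of    *)
(* domain.                                                                    *)
Lemma product_interior s f d d' x : facet_dual A f d -> facet_dual A (s \o f) d' ->
  cube_interior x -> product_at s x -> cube_interior (F x).
Proof.
move=> [fd f0] [_ sf0] [r1 r10 r1X] [r2 r20 Hr2].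
pose r := Num.min r1 r2 / 2.
have r0 : 0 < r.
  have : 0 < Num.min r1 r2 by rewrite lt_min r10 r20.
  by rewrite /r; lra.
have rr1 : r * 2 <= r1 by rewrite /r divfK // ge_min lexx.
have rr2 : r <= r2.
  have : r * 2 <= r2 by rewrite /r divfK // ge_min lexx orbT.
  lra.
have cX z : cube x r z -> X z.
  by move=> /(cube_sub A _ _ r1) xz; apply: r1X; apply: xz; lra.
have cI z : cube x r z -> cube_interior z.
  have r20' : 0 < r * 2 by rewrite mulr_gt0.
  have := cube_half_interior x (r * 2) r20'; rewrite mulfK // => H xz; apply: H => // y.
  by move=> /(cube_sub A _ _ r1 rr1) /r1X.
have {}Hr2 z z' i : cube x r z -> cube x r z' -> facet i z = facet i z' ->
    facet (s i) (F z) = facet (s i) (F z').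
  by move=> /(cube_sub A _ _ _ rr2) xz /(cube_sub A _ _ _ rr2) xz'; exact: Hr2.
have [D D0 HD] := finite_ubound (fun p : 'I_m * 'I_n => facet p.1 (d p.2)).
have {}HD l i : `|facet l (d i)| <= D := HD (l, i).
have [Me Me0 HMe] := finite_ubound (fun i => facet i e).
have {}HMe l : facet l e <= Me by apply: le_trans (HMe l); exact: ler_norm.
have [be be0 Hbe] := finite_pos_lbound _ he.
(* The first bound keeps the box spanned by the [d i] inside [cube x r]; the second does so for the
   points along [e] with the same change in functional [f i]. *)
pose dl := Num.min (r / (2 * n.+1%:R * D)) (r * be / (2 * Me)).
have nD0 : 0 < 2 * n.+1%:R * D by rewrite !mulr_gt0.
have dl0 : 0 < dl.
  by rewrite lt_min; apply/andP; split; apply: divr_gt0 => //; apply: mulr_gt0.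
have dlD : n%:R * (dl * D) < r.
  apply: (@le_lt_trans _ _ (n.+1%:R * (dl * D))).
    by rewrite ler_wpM2r ?ler_nat // mulr_ge0 // ltW.
  have : dl <= r / (2 * n.+1%:R * D) by rewrite ge_min lexx.
  rewrite ler_pdivlMr // (_ : dl * (2 * n.+1%:R * D) = 2 * (n.+1%:R * (dl * D))); last by ring.
  have : 0 < n.+1%:R * (dl * D) by rewrite !mulr_gt0.
  lra.
have dle : dl / be * Me < r.
  have : dl <= r * be / (2 * Me) by rewrite ge_min lexx orbT.
  rewrite ler_pdivlMr ?mulr_gt0 // => h.
  rewrite mulrAC ltr_pdivrMr //.
  have : 0 < r * be by rewrite mulr_gt0.
  lra.
have box (t : 'I_n -> R) : (forall i, `|t i| <= dl) -> cube x r (x + \sum_i t i *: d i).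
  move=> tdl l; rewrite facetD facet_sum.
  have : `|\sum_i facet l (t i *: d i)| < r.
    apply: le_lt_trans (ler_norm_sum _ _ _) _; apply: le_lt_trans dlD.
    rewrite mulr_natl -[X in _ *+ X]card_ord -sumr_const; apply: ler_sum => i _.
    by rewrite facetZ normrM ler_pM.
  by rewrite ltr_norml => /andP[? ?]; apply/andP; split; lra.
have fbox (t : 'I_n -> R) j : facet (f j) (x + \sum_i t i *: d i) = facet (f j) x + t j.
  rewrite facetD facet_sum (bigD1 j) //= facetZ fd eqxx mulr1 big1 ?addr0 //.
  by move=> i ij; rewrite facetZ fd (negbTE ij) mulr0.
have dE i t : x + t *: d i = x + \sum_j (if j == i then t else 0) *: d j.
  congr (_ + _); rewrite (bigD1 i) //= eqxx big1 ?addr0 // => j ji.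
  by rewrite (negbTE ji) scale0r.
have line i t : `|t| <= dl -> cube x r (x + t *: d i).
  by move=> tdl; rewrite dE; apply: box => j; case: ifP => // _; rewrite normr0 ltW.
have fline i t j : facet (f j) (x + t *: d i) = facet (f j) x + (if j == i then t else 0).
  by rewrite dE fbox.
pose g i t := facet (s (f i)) (F (x + t *: d i)).
have g0 i : g i 0 = facet (s (f i)) (F x) by rewrite /g scale0r addr0.
have dl0' : `|0 : R| <= dl by rewrite normr0 ltW.
have ginj i t t' : `|t| <= dl -> `|t'| <= dl -> g i t = g i t' -> t = t'.
  move=> tdl tdl' gtt'.
  have : x + t *: d i = x + t' *: d i.
    apply: Finj; [exact/cX/line|exact/cX/line|].
    apply/subr0_eq/sf0 => j /=; rewrite !facetE; apply/eqP; rewrite subr_eq0; apply/eqP.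
    have [->|ji] := eqVneq j i; first exact: gtt'.
    by apply: Hr2; [exact: line|exact: line|rewrite !fline (negbTE ji)].
  by move=> /(congr1 (facet (f i))); rewrite !fline eqxx => /addrI.
(* [d i] need not lie in the cone. By the product form, [x + t *: d i] may be replaced by a point on
   the line along [e] with the same value of [f i], which is comparable with [x]. *)
have gmono i t : `|t| <= dl -> 0 <= t -> g i 0 <= g i t.
  move=> tdl t0; pose z := x + (t / facet (f i) e) *: e.
  have xz : cube x r z.
    have te : 0 <= t / facet (f i) e by rewrite divr_ge0 // ltW.
    move=> l; rewrite !facetE.
    have : 0 <= t / facet (f i) e * facet l e < r.
      rewrite mulr_ge0 // ?(ltW (he l)) //=; apply: le_lt_trans dle; apply: ler_pM => //.
        by rewrite ltW.
      apply: ler_pM => //; rewrite ?invr_ge0 ?(ltW (he _)) //; first by rewrite -[t]ger0_norm.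
      by rewrite lef_pV2 ?posrE.
    by move=> /andP[? ?]; apply/andP; split; lra.
  have -> : g i t = facet (s (f i)) (F z).
    apply: Hr2 => //; first exact: line.
    by rewrite fline eqxx /z !facetE divfK // gt_eqF.
  rewrite g0; apply: Fmono; [exact/cX/cube_center|exact: cX|].
  by move=> l; rewrite /z !facetE lerDl mulr_ge0 ?divr_ge0 // ltW.
have gmono' i t : `|t| <= dl -> 0 <= t -> g i (- t) <= g i 0.
  move=> tdl t0; pose z := x - (t / facet (f i) e) *: e.
  have xz : cube x r z.
    have te : 0 <= t / facet (f i) e by rewrite divr_ge0 // ltW.
    move=> l; rewrite !facetE.
    have : 0 <= t / facet (f i) e * facet l e < r.
      rewrite mulr_ge0 // ?(ltW (he l)) //=; apply: le_lt_trans dle; apply: ler_pM => //.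
        by rewrite ltW.
      apply: ler_pM => //; rewrite ?invr_ge0 ?(ltW (he _)) //; first by rewrite -[t]ger0_norm.
      by rewrite lef_pV2 ?posrE.
    by move=> /andP[? ?]; apply/andP; split; lra.
  have -> : g i (- t) = facet (s (f i)) (F z).
    apply: Hr2 => //; first by apply: line; rewrite normrN.
    by rewrite fline eqxx /z !facetE divfK // gt_eqF.
  rewrite g0; apply: Fmono; [exact: cX|exact/cX/cube_center|].
  by move=> l; rewrite /z !facetE gerDl oppr_le0 mulr_ge0 ?divr_ge0 // ltW.
have dld : `|dl| <= dl by rewrite gtr0_norm.
have dld' : `|- dl| <= dl by rewrite normrN gtr0_norm.
have gup i : 0 < g i dl - g i 0.
  rewrite subr_gt0 lt_neqAle gmono ?(ltW dl0) // andbT; apply/eqP => /ginj.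
  by move=> /(_ dl0' dld) h; rewrite -h ltxx in dl0.
have glo i : 0 < g i 0 - g i (- dl).
  rewrite subr_gt0 lt_neqAle gmono' ?(ltW dl0) // andbT; apply/eqP => /ginj.
  by move=> /(_ dld' dl0') /eqP; rewrite oppr_eq0 gt_eqF.
have [b1 b10 Hb1] := finite_pos_lbound _ gup.
have [b2 b20 Hb2] := finite_pos_lbound _ glo.
exists (Num.min b1 b2); first by rewrite lt_min b10.
move=> w Fw.
have gc i : {within `[- dl, dl], continuous (g i)}.
  apply: continuous_in_subspaceT => t; rewrite inE /= in_itv /= => tdl.
  have tdl' : `|t| <= dl by rewrite ler_norml.
  apply/cvgrPdist_lt => eps eps0.
  have [dd dd0 Hdd] := Fcont 1 _ (cI _ (line i t tdl')) _ eps0.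
  have [d1 d10 Hd1] := cube_ray (x + t *: d i) (d i) dd dd0.
  apply/nbhs_ballP; exists d1 => //= t' /=; rewrite /ball /= => tt'.
  have := Hd1 (t' - t); rewrite distrC => /(_ (ltW tt')).
  rewrite (_ : x + t *: d i + (t' - t) *: d i = x + t' *: d i); last first.
    by rewrite scalerBl addrA addrAC addrK.
  move=> /Hdd /(_ (s (f i))) /=.
  rewrite addrC -/(g i t) -/(g i t') => /andP[? ?].
  by rewrite ltr_distl; apply/andP; split; lra.
(* Each coordinate of [w] is attained separately; the product form then combines the parameters
   [t i] into one preimage. *)
have gw i : exists t, `|t| <= dl /\ g i t = facet (s (f i)) w.
  have ab : - dl <= dl by lra.
  have := IVT ab (gc i); move=> /(_ (facet (s (f i)) w)) [|t].
    have := gup i; have := glo i => *; rewrite min_l ?max_r; [|lra|lra].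
    have := Fw (s (f i)); rewrite -g0; have := Hb1 i; have := Hb2 i.
    have : Num.min b1 b2 <= b1 by rewrite ge_min lexx.
    have : Num.min b1 b2 <= b2 by rewrite ge_min lexx orbT.
    by move=> ? ? ? ? /andP[? ?]; apply/andP; split; lra.
  by rewrite in_itv /= => tdl gt; exists t; rewrite ler_norml.
have /choice [t Ht] := gw.
have xz := box t (fun i => (Ht i).1).
rewrite -(_ : F (x + \sum_i t i *: d i) = w); first by apply: FX; exact: cX.
apply/subr0_eq/sf0 => j /=; rewrite !facetE; apply/eqP; rewrite subr_eq0; apply/eqP.
rewrite -(Ht j).2; apply: Hr2 => //; first by apply: line; exact: (Ht j).1.
by rewrite fbox fline eqxx.
Qed.

End AnalyticContinuation.

Section Periodicity.
Context {R : realType} {n m : nat} (A : 'M[R]_(m, n)).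
Local Notation V := 'rV[R]_n.
Local Notation facet := (facet A).
Local Notation cube := (cube A).
Local Notation facet_le := (facet_le A).
Context (e : V) (he : forall i, 0 < facet i e).
Context (u : 'I_m -> V) (u0 : forall i, facet i (u i) = 0)
  (u1 : forall i l, l != i -> 0 < facet l (u i)).
Context (facet_inj : forall x, (forall i, facet i x = 0) -> x = 0).
Context (X : set V) (F : V -> V) (FX : forall x, X x -> X (F x)).
Context (Fmono : forall x y, X x -> X y -> facet_le x y -> facet_le (F x) (F y)).
Context (Finj : forall x y, X x -> X y -> F x = F y -> x = y).
Local Notation cube_interior := (cube_interior A X).
Context (Fcont : forall k x, cube_interior x -> continuous_in_cubes A (iter k F) x).
Context (Fan : forall i x v, cube_interior x ->
  analytic_at (fun t => facet i (F (x + t *: v))) 0).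
Context (Xconn : forall Q : set V, (exists x, cube_interior x /\ Q x) ->
  (forall x, cube_interior x -> Q x -> exists2 r, 0 < r & cube x r `<=` Q) ->
  (forall x, cube_interior x -> (forall r, 0 < r -> exists y, cube x r y /\ Q y) -> Q x) ->
  cube_interior `<=` Q).

(* The facet functional s i of the next iterate is an analytic function of    *)
(* the facet functional i of the current one, hence one-variable composition  *)
(* suffices.                                                                  *)
Lemma facet_iter_analytic (s : {perm 'I_m}) k i (y v : V) t :
  (forall x, cube_interior x -> product_at A F s x) ->
  (forall x, cube_interior x -> cube_interior (F x)) ->
  cube_interior (y + t *: v) ->
  analytic_at (fun t => facet i (iter k F (y + t *: v))) t.
Proof.
move=> Fprod FI Ix; elim: k i => [|k IH] i.
  have := analytic_at_affine (facet i y) (facet i v) t; congr (analytic_at _ _).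
  by apply/funext => a /=; rewrite !facetE mulrC.
set x0 := y + t *: v in Ix; set w0 := iter k F x0.
have Iw0 : cube_interior w0 by exact: iter_stable.
have [r r0 Hr] := Fprod _ Iw0.
pose j := (s^-1)%g i; have sj : s j = i by rewrite /j permKV.
(* Along [e'] functional [j] moves at unit speed, so [h] expresses functional [i] of [F] as a
   function of the value of functional [j]. *)
pose e' := (facet j e)^-1 *: e.
have fe' : facet j e' = 1 by rewrite facetZ mulVf // gt_eqF.
pose h a := facet i (F (w0 + (a - facet j w0) *: e')).
have hA : analytic_at h (facet j w0).
  apply: analytic_at_shift.
  have -> : (fun a => h (facet j w0 + a)) = (fun a => facet i (F (w0 + a *: e'))).
    apply/funext => a; rewrite /h.
    have -> : facet j w0 + a - facet j w0 = a by ring.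
    by [].
  exact: Fan.
have [d d0 Hd] := cube_ray A w0 e' r r0.
have rd0 : 0 < Num.min r d by rewrite lt_min r0.
have [d1 d10 Hd1] := Fcont k _ Ix _ rd0.
have [d2 d20 Hd2] := cube_ray A x0 v d1 d10.
apply: (analytic_at_near _ _ t d2 d20) (analytic_at_comp _ _ _ (IH j) hA).
move=> a ad2; rewrite /= /h; set z := iter k F (y + a *: v).
have zc : cube w0 (Num.min r d) z.
  have := Hd2 (a - t) (ltW ad2); rewrite (_ : x0 + (a - t) *: v = y + a *: v); first exact: Hd1.
  by rewrite /x0 scalerBl addrA addrAC addrK.
rewrite -sj; apply: Hr.
- apply: Hd; have := zc j; have : Num.min r d <= d by rewrite ge_min lexx orbT.
  by move=> ? /andP[? ?]; rewrite ler_norml; apply/andP; split; lra.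
- by apply: cube_sub zc; rewrite ge_min lexx.
- by rewrite facetD facetZ fe'; lra.
Qed.

Theorem periodic_on_interior c r : 0 < r -> cube c r `<=` X ->
  dense_in_cube A (periodic_in X F) c r ->
  exists2 N, (0 < N)%N & forall x, cube_interior x -> iter N F x = x.
Proof.
move=> r0 cX Pd.
have [N [c' [r' [N0 r'0 c'c HN]]]] :=
  periodic_on_cube A e he u u0 u1 facet_inj X F FX Fmono c r r0 cX Pd.
have c'X : cube c' r' `<=` X by move=> z /c'c /cX.
have cI z : cube c' r' z -> cube_interior z.
  by move=> /(cube_open A)[b b0 zb]; exists b => // y /zb /c'X.
(* From the dense periodic points to the whole cube, by continuity of F^N. *)
have {}HN x : cube c' r' x -> iter N F x = x.
  move=> xc; apply: (facet_eq A facet_inj) => i; apply/eqP; rewrite -subr_eq0 -normr_le0.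
  apply/ler_addgt0Pr => eps eps0; rewrite add0r.
  have e2 : 0 < eps / 2 by rewrite divr_gt0.
  have [d d0 Hd] := Fcont N _ (cI _ xc) _ e2.
  have [b b0 Hb] := cube_open A _ _ _ xc.
  pose rho := Num.min b (Num.min d (eps / 2)).
  have rho0 : 0 < rho by rewrite !lt_min b0 d0.
  have [p [Pp xp]] := Pd x rho (c'c _ xc) rho0.
  have pc : cube c' r' p by apply: Hb; apply: cube_sub xp; rewrite ge_min lexx.
  have dxp : cube x d p by apply: cube_sub xp; rewrite !ge_min lexx !orbT.
  have := Hd p dxp i; rewrite (HN p Pp pc) => /andP[h1 h2].
  have : rho <= eps / 2 by rewrite !ge_min lexx !orbT.
  have /andP[] := xp i => *; rewrite ler_norml; apply/andP; split; lra.
have [s [eta [/andP[eta0 eta1] Hs]]] :=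
  local_product A e he u u0 u1 X F FX Fmono c' r' N r'0 c'X N0 HN
    (fun x xc => Fcont 1 x (cI x xc)).
have cc : cube c' eta c' by exact: cube_center.
have Ic' : cube_interior c' by apply: cI; exact: cube_center.
have Fprod : cube_interior `<=` product_at A F s.
  apply: (product_propagates A X F Fan Xconn); exists c'; split=> //.
  by exists eta => // z z' i zc zc'; exact: (Hs i z' z zc' zc).2.
have [f fA] := facet_basis A facet_inj.
have [d Hd] := facet_dual_exists A f fA.
(* Moving along [d i] changes functional [s (f i)] of [F] strictly, and none of the other [s (f j)];
   this contradicts a linear relation in which functional [s (f i)] has a nonzero coefficient. *)
have [d' Hd'] : exists d', facet_dual A (s \o f) d'.
  apply: facet_dual_exists; apply/negPn/negP => /facet_dependence[a [[i ai] Ha]].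
  have [t1 t10 Ht1] := cube_ray A c' (d i) eta eta0.
  have cz : cube c' eta (c' + t1 *: d i) by apply: Ht1; rewrite gtr0_norm.
  have fz j : facet (f j) (c' + t1 *: d i) = facet (f j) c' + t1 * (i == j)%:R.
    by rewrite !facetE Hd.1.
  have := Ha (F (c' + t1 *: d i)); have := Ha (F c').
  rewrite (bigD1 i) //= => E1; rewrite (bigD1 i) //=.
  under eq_bigr => j ji.
    rewrite (_ : facet (s (f j)) _ = facet (s (f j)) (F c')); first over.
    by apply: (Hs (f j) _ _ _ _).2; rewrite // fz eq_sym (negbTE ji) mulr0 addr0.
  rewrite -[RHS]E1 => /addIr /(mulfI ai) E.
  have := (Hs (f i) (c' + t1 *: d i) c' cz cc).1.
  by rewrite fz eqxx mulr1 ltrDl E ltxx => /(_ t10).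
have FI x : cube_interior x -> cube_interior (F x).
  move=> Ix.
  exact: (product_interior A e he X F FX Fmono Finj Fcont s f d d' x Hd Hd' Ix (Fprod _ Ix)).
exists N => //.
(* Being the identity near a point is an open condition; along segments from a nearby good point,
   the identity theorem makes it closed in the interior. *)
suff H : cube_interior `<=` [set x | exists2 rho, 0 < rho & forall z, cube x rho z -> iter N F z = z].
  by move=> x /H[rho rho0]; apply; exact: cube_center.
apply: Xconn => [|x Ix [rho rho0 Hrho]|x Ix near_x].
- by exists c'; split=> //; exists r'.
- exists (rho / 2); first by rewrite divr_gt0.
  move=> y xy; exists (rho / 2); first by rewrite divr_gt0.
  by move=> z /(cube_shift A _ _ _ _ xy); rewrite -splitr; exact: Hrho.
have [rx rx0 xX] := Ix; have r20 : 0 < rx / 2 by rewrite divr_gt0.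
have xI := cube_half_interior A X x rx rx0 xX.
have [y [xy [rho rho0 Hy]]] := near_x _ r20.
exists (rx / 2) => // z xz; apply: (facet_eq A facet_inj) => i.
have [d1 d10 Hd1] := cube_ray A y (z - y) rho rho0.
have seg t : 0 <= t <= 1 -> cube_interior (y + t *: (z - y)).
  by move=> t01; apply: xI; exact: cube_convex.
have := analytic_identity (fun t => facet i (iter N F (y + t *: (z - y))) -
  facet i (iter 0 F (y + t *: (z - y)))) d1 d10.
rewrite !scale1r ![y + (_ - y)]addrC !subrK => H; apply/subr0_eq/H.
  by move=> t t01; apply: analytic_atB; apply: (facet_iter_analytic s) => //; exact: seg.
by move=> t /andP[t0 td1]; rewrite Hy ?subrr //; apply: Hd1; rewrite ger0_norm.
Qed.

End Periodicity.

(** * Polyhedral cones and subspace topologies *)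

Section PolyhedralCones.
Context {R : realType} {n : nat}.
Local Notation V := 'rV[R]_n.
Implicit Types (K : set V).

Lemma nbhs_rowP (x : V) (B : set V) : nbhs x B <->
  exists2 eps : R, 0 < eps & forall z : V, (forall j, `|x 0 j - z 0 j| < eps) -> B z.
Proof.
split=> [/nbhs_ballP[eps /= eps0 xB]|[eps eps0 xB]].
  exists eps => // z xz; apply: xB; split=> // i j.
  by rewrite !ord1 /ball /=; exact: xz.
apply/nbhs_ballP; exists eps => // z [_ xz]; apply: xB => j.
exact: xz.
Qed.

Lemma nbhs_ray (x v : V) (B : set V) : nbhs x B ->
  exists2 d : R, 0 < d & B (x + d *: v).
Proof.
move=> /nbhs_rowP[eps eps0 xB]; have [M M0 HM] := finite_ubound (fun j => v 0 j).
exists (eps / (2 * M)); first by rewrite divr_gt0 // mulr_gt0.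
apply: xB => j; rewrite !mxE opprD addNKr normrN normrM.
rewrite gtr0_norm ?divr_gt0 ?mulr_gt0 //.
apply: (@le_lt_trans _ _ (eps / (2 * M) * M)).
  by rewrite ler_wpM2l // divr_ge0 // ?mulr_ge0 // ltW.
by rewrite invfM mulrA divfK ?gt_eqF //; lra.
Qed.

Definition facet_cone m (A : 'M[R]_(m, n)) : set V := [set x | forall i, 0 <= facet A i x].

(** A linear form bounded above on a cone is nonpositive there, and every bound [b i] is nonnegative
    since 0 lies in the cone; so the bounds may be replaced by 0. *)
Lemma polyhedral_cone_facets K : K !=set0 -> is_cone K -> is_polyhedron K ->
  exists m (A : 'M[R]_(m, n)), K = facet_cone m A.
Proof.
move=> [x0 Kx0] Kcone [m [a [b [_ KE]]]].
have KP x : K x <-> forall i, \sum_j a i 0 j * x 0 j <= b i.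
  by rewrite KE; split=> [H i|H i _]; [exact: H|exact: H].
have b0 i : 0 <= b i.
  have : K 0 by rewrite -(scale0r x0); exact: Kcone.
  by move=> /KP/(_ i); rewrite big1 // => j _; rewrite mxE mulr0.
exists m, (\matrix_(i, j) - a i 0 j); apply/seteqP.
have fE i x : facet (\matrix_(i, j) - a i 0 j) i x = - \sum_j a i 0 j * x 0 j.
  by rewrite /facet mxE -sumrN; apply: eq_bigr => j _; rewrite !mxE mulrN mulrC.
split=> x Kx; last by apply/KP => i; have := Kx i; rewrite fE oppr_ge0 => /le_trans; apply.
move=> i; rewrite fE oppr_ge0 leNgt; apply/negP; set s := \sum_j _ => s0.
have t0 : 0 <= (b i + 1) / s by rewrite divr_ge0 ?addr_ge0 // ltW.
have := (KP _).1 (Kcone _ _ t0 Kx) i.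
have -> : \sum_j a i 0 j * (((b i + 1) / s) *: x) 0 j = b i + 1.
  transitivity ((b i + 1) / s * s); last by rewrite divfK // gt_eqF.
  by rewrite mulr_sumr; apply: eq_bigr => j _; rewrite mxE mulrCA.
lra.
Qed.

(** In a description with the fewest functionals, dropping one enlarges the cone; a point gained
    violates that functional alone. *)
Lemma irredundant_facets K : (exists m (A : 'M[R]_(m, n)), K = facet_cone m A) ->
  exists m (A : 'M[R]_(m, n)), K = facet_cone m A /\
    forall i, exists v, facet A i v < 0 /\ forall l, l != i -> 0 <= facet A l v.
Proof.
move=> ex; pose P m := `[< exists A : 'M[R]_(m, n), K = facet_cone m A >].
have exP : exists m, P m by case: ex => m HA; exists m; exact/asboolP.
case: (ex_minnP exP) => m /asboolP[A KA] minm; exists m, A; split=> // i.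
apply: contrapT => nv; case: m => [|m] in A KA minm i nv *; first by case: i nv => [].
suff /minm : P m by rewrite ltnn.
apply/asboolP; exists (row' i A).
have fE j x : facet (row' i A) j x = facet A (lift i j) x.
  by rewrite /facet !mxE; apply: eq_bigr => k _; rewrite !mxE.
rewrite KA; apply/seteqP; split=> x Kx j; first by rewrite fE.
rewrite leNgt; apply/negP => xj; apply: nv; exists x.
have lx l : l != i -> 0 <= facet A l x.
  by rewrite eq_sym => /unlift_some[k -> _]; rewrite -fE.
have [ji|/lx] := eqVneq j i; first by rewrite -ji; split=> // l; rewrite ji; exact: lx.
by rewrite leNgt xj.
Qed.

(** An interior point has positive functionals, since one can move from it towards a point violating
    any given one. Correcting such a violator along [e] puts it on the facet, giving [u i]. A common
    zero of all functionals would span a line in the cone. *)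
Lemma solid_order_cone_facets K : solid_order_cone K -> is_polyhedron K ->
  exists m (A : 'M[R]_(m, n)) e u,
    [/\ K = facet_cone m A, forall i, 0 < facet A i e, forall i, facet A i (u i) = 0,
        forall i l, l != i -> 0 < facet A l (u i) &
        forall x, (forall i, facet A i x = 0) -> x = 0].
Proof.
move=> [_ _ Kcone [e Ke] Kpointed] Kpoly.
have [|m [A [KA Av]]] := irredundant_facets K.
  by apply: polyhedral_cone_facets => //; exists e; exact: interior_subset.
have e0 i : 0 < facet A i e.
  have [v [iv _]] := Av i; have [d d0] := nbhs_ray e v _ Ke.
  rewrite KA => /(_ i); rewrite !facetE.
  have : d * facet A i v < 0 by rewrite pmulr_rlt0.
  lra.
have /choice[u Hu] i : exists u, facet A i u = 0 /\ forall l, l != i -> 0 < facet A l u.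
  have [v [iv lv]] := Av i; exists (v + (- facet A i v / facet A i e) *: e); split.
    by rewrite !facetE divfK ?subrr // gt_eqF.
  move=> l li; rewrite !facetE ltr_wpDl ?lv // mulr_gt0 // divr_gt0 // oppr_gt0 //.
exists m, A, e, u; split=> // [i|i l|x x0]; [exact: (Hu i).1|exact: (Hu i).2|].
apply: contrapT => /eqP xn0; apply: Kpointed.
exists [set 0 + t *: x | t in [set: R]]; split; first by exists 0, x.
by move=> _ [t _ <-]; rewrite KA => i; rewrite add0r facetZ x0 mulr0.
Qed.

Lemma nbhs_cubeP m (A : 'M[R]_(m, n)) x (B : set V) :
  (forall x, (forall i, facet A i x = 0) -> x = 0) ->
  nbhs x B <-> exists2 r, 0 < r & cube A x r `<=` B.
Proof.
move=> inj; have n0 : 0 < n.+1%:R :> R by rewrite ltr0n.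
split=> [/nbhs_rowP[eps eps0 xB]|[r r0 xB]].
  have [f fA] := facet_basis A inj; have [d [Hd d0]] := facet_dual_exists A f fA.
  have [D D0 HD] := finite_ubound (fun p : 'I_n * 'I_n => d p.1 0 p.2).
  have {}HD i j : `|d i 0 j| <= D := HD (i, j).
  (* [n.+1] rather than [n] keeps the quotient meaningful in dimension 0 and the final inequality
     strict. *)
  exists (eps / (n.+1%:R * D)); first by rewrite divr_gt0 // mulr_gt0.
  set r := eps / _ => z zx; apply: xB => j.
  have E : x - z = \sum_i facet A (f i) (x - z) *: d i.
    apply/subr0_eq/d0 => k; rewrite facetD facetN facet_sum (bigD1 k) //= facetZ Hd eqxx mulr1.
    rewrite big1 ?addr0 ?subrr // => i ik; rewrite facetZ Hd (negbTE ik) mulr0 //.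
  have -> : x 0 j - z 0 j = (x - z) 0 j by rewrite !mxE.
  rewrite E summxE; apply: (@le_lt_trans _ _ (\sum_(i < n) r * D)).
    apply: le_trans (ler_norm_sum _ _ _) _; apply: ler_sum => i _.
    rewrite mxE normrM ler_pM // !facetE ltW // ltr_norml.
    by have /andP[? ?] := zx (f i); apply/andP; split; lra.
  rewrite sumr_const card_ord -mulr_natl.
  have rD : 0 < r * D by rewrite /r invfM mulrA mulfVK ?gt_eqF // divr_gt0.
  have : n.+1%:R * (r * D) = eps by rewrite /r; field; rewrite !gt_eqF.
  by rewrite -natr1 mulrDl mul1r; lra.
apply/nbhs_rowP; have [M M0 HM] := finite_ubound (fun p : 'I_m * 'I_n => A p.1 p.2).
have {}HM i j : `|A i j| <= M := HM (i, j).
exists (r / (n.+1%:R * M)); first by rewrite divr_gt0 // mulr_gt0.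
set eps := r / _ => z xz; apply: xB => i.
have : `|facet A i (x - z)| < r.
  rewrite /facet mxE; apply: (@le_lt_trans _ _ (\sum_(j < n) eps * M)).
    apply: le_trans (ler_norm_sum _ _ _) _; apply: ler_sum => j _.
    by rewrite !mxE normrM ler_pM // ltW.
  rewrite sumr_const card_ord -mulr_natl.
  have rD : 0 < eps * M by rewrite /eps invfM mulrA mulfVK ?gt_eqF // divr_gt0.
  have : n.+1%:R * (eps * M) = r by rewrite /eps; field; rewrite !gt_eqF.
  by rewrite -natr1 mulrDl mul1r; lra.
by rewrite !facetE ltr_norml => /andP[? ?]; apply/andP; split; lra.
Qed.

End PolyhedralCones.

(** * Self-maps of a subspace as maps of the whole space *)

Section SelfMapsOfSubsets.
Context {R : realType} {n : nat} (X : set 'rV[R]_n) (T : X -> X).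
Local Notation V := 'rV[R]_n.

(** Extending by the identity off [X] gives a map that can be evaluated at [x + t *: v] without
    carrying a membership proof. *)
Definition extend_map (x : V) : V := oapp (fun y : X => val (T y)) x (insub x).

Lemma extend_map_val (y : X) : extend_map (val y) = val (T y).
Proof. by rewrite /extend_map valK. Qed.

Lemma iter_extend_map_val k (y : X) : iter k extend_map (val y) = val (iter k T y).
Proof. by elim: k => //= k ->; exact: extend_map_val. Qed.

Lemma set_type_ex x : X x -> exists y : X, val y = x.
Proof. by move=> Xx; exists (exist _ x (mem_set Xx)). Qed.

Lemma nbhs_set_typeP (y : X) (B : set X) :
  nbhs y B <-> exists2 W : set V, nbhs (val y) W & forall z : X, W (val z) -> B z.
Proof.
split=> [|[W Wy WB]].
  case=> _ /= [[W oW <-] /= Wy WB]; exists W; last by move=> z Wz; exact: WB.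
  by move: oW; rewrite openE; exact.
have yW : nbhs y (set_val @^-1` W) := @initial_continuous X V set_val y W Wy.
by apply: filterS yW => z; exact: WB.
Qed.

Lemma iter_continuous k : continuous T -> continuous (iter k T).
Proof.
move=> Tc; elim: k => [|k IH] x; first exact: cvg_id.
by apply: (@continuous_comp _ _ _ (iter k T) T); [exact: IH|exact: Tc].
Qed.

End SelfMapsOfSubsets.

Theorem theorem3 (R : realType) (n : nat) (K : set 'rV[R]_n)
    (hK : solid_order_cone K) (hKpoly : is_polyhedron K)
    (X : set 'rV[R]_n) (hX0 : X !=set0)
    (hXconn : connected X°)
    (hXdense : dense [set x : X | X° (val x)])
    (T : X -> X)
    (hTinj : injective T) (hTcont : continuous T)
    (hTmono : forall x y : X, cone_le K (val y) (val x) ->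
                              cone_le K (val (T y)) (val (T x)))
    (hTan : analytic_on_interior (fun x : X => val (T x)))
    (hTnper : ~ periodic_map T) :
  nowhere_dense (periodic_points T).
Proof.
have [m [A [e [u [KA he u0 u1 inj]]]]] := solid_order_cone_facets K hK hKpoly.
have nbhs_cube x B := nbhs_cubeP m A x B inj.
have cube_nbhs x r : 0 < r -> nbhs x (cube A x r) by move=> r0; apply/nbhs_cube; exists r.
have intE x : cube_interior A X x <-> X° x by split=> [/nbhs_cube|/nbhs_cube].
have leE (x y : X) : cone_le K (val y) (val x) <-> facet_le A (val y) (val x).
  rewrite /cone_le KA; split=> h i; have := h i; rewrite facetD facetN; lra.
pose F := extend_map X T.
have FX x : X x -> X (F x).
  by move=> /set_type_ex[y <-]; rewrite /F extend_map_val; exact: set_valP.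
have Fmono x y : X x -> X y -> facet_le A x y -> facet_le A (F x) (F y).
  move=> /set_type_ex[x' <-] /set_type_ex[y' <-]; rewrite /F !extend_map_val.
  by move=> /leE /hTmono /leE.
have Finj x y : X x -> X y -> F x = F y -> x = y.
  move=> /set_type_ex[x' <-] /set_type_ex[y' <-]; rewrite /F !extend_map_val.
  by move=> /val_inj /hTinj ->.
have Fcont0 k (y : X) eps : 0 < eps -> exists2 W, nbhs (val y) W &
    forall z : X, W (val z) -> cube A (val (iter k T y)) eps (val (iter k T z)).
  move=> eps0; have : nbhs (iter k T y) [set z : X | cube A (val (iter k T y)) eps (val z)].
    by apply/nbhs_set_typeP; exists (cube A (val (iter k T y)) eps) => //; exact: cube_nbhs.
  by move=> /(iter_continuous X T k hTcont) /nbhs_set_typeP.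
have Fcont k x : cube_interior A X x -> continuous_in_cubes A (iter k F) x.
  move=> Ix eps eps0; have Xx : X x by apply: interior_subset; exact/intE.
  have [y yx] := set_type_ex X _ Xx; rewrite -yx in Ix *.
  have [W Wy HW] := Fcont0 k y _ eps0.
  have /nbhs_cube[d d0 Hd] : nbhs (val y) (W `&` X) by apply: filterI => //; exact/intE.
  exists d => // z /Hd[Wz /set_type_ex[z' zz']]; rewrite -zz' in Wz *.
  by rewrite /F !iter_extend_map_val; exact: HW.
have Fan i x v : cube_interior A X x -> analytic_at (fun t => facet A i (F (x + t *: v))) 0.
  move=> Ix; have Xx : X x by apply: interior_subset; exact/intE.
  have [y yx] := set_type_ex X _ Xx.
  have -> : (fun t => facet A i (F (x + t *: v))) =
            (fun t => \sum_j A i j * F (x + t *: v) 0 j).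
    by apply/funext => t; rewrite /facet mxE; apply: eq_bigr => j _; rewrite mxE mulrC.
  apply: analytic_at_sum => j; apply: analytic_atZ.
  have [|c] := hTan y _ j; first by rewrite yx; exact/intE.
  move=> /nbhs_set_typeP[W Wy HW].
  have /nbhs_cube[r r0 Hr] : nbhs x (W `&` X).
    by apply: filterI; [rewrite -yx|exact/intE].
  have [d d0 Hd] := cube_ray A x v r r0.
  (* The direction is scaled by [d] so that the power series is valid for all |t| <= 1; composing
     with t / d undoes the scaling. *)
  have := power_series_analytic_at c (d *: v) (fun t => F (x + t *: (d *: v)) 0 j) _.
  set h := fun t => F (x + t *: (d *: v)) 0 j => hA.
  have {}hA : analytic_at h 0.
    apply: hA => t t1; have := Hd (t * d); rewrite normrM (gtr0_norm d0) ler_piMl ?(ltW d0) //.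
    move=> /(_ isT) /Hr; rewrite -scalerA => -[Wz /set_type_ex[z zz]].
    rewrite -zz in Wz; have := HW z Wz; rewrite /h /= yx zz addrC addKr.
    by rewrite -zz /F extend_map_val.
  have -> : (fun t => F (x + t *: v) 0 j) = h \o (fun t => 0 + d^-1 * t).
    apply/funext => t; rewrite /h /= add0r scalerA.
    by have -> : d^-1 * t * d = t by field; rewrite gt_eqF.
  apply: analytic_at_comp; first exact: analytic_at_affine.
  by rewrite mulr0 addr0.
have Xconn (Q : set 'rV[R]_n) : (exists x, cube_interior A X x /\ Q x) ->
  (forall x, cube_interior A X x -> Q x -> exists2 r, 0 < r & cube A x r `<=` Q) ->
  (forall x, cube_interior A X x -> (forall r, 0 < r -> exists y, cube A x r y /\ Q y) -> Q x) ->
  cube_interior A X `<=` Q.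
  move=> [x [Ix Qx]] Qo Qc; pose B := X° `&` Q.
  suff BX : B = X° by move=> y /intE; rewrite -BX => -[].
  apply: hXconn; first by exists x; split=> //; exact/intE.
    exists B; last by rewrite /B setIA setIid.
    rewrite openE => y [Iy Qy]; apply: filterI.
      by have := @open_interior _ X; rewrite openE; exact.
    by apply/nbhs_cube; apply: Qo => //; exact/intE.
  exists (closure B); first exact: closed_closure.
  apply/seteqP; split=> [y By|y [Iy By]]; first by split; [exact: By.1|exact: subset_closure].
  split=> //; apply: Qc; first exact/intE.
  move=> r r0; have [z [[_ Qz] yz]] := By _ (cube_nbhs y r r0).
  by exists z.
rewrite /nowhere_dense -subset0 => y0 Iy0; apply: hTnper.
(* Density of the interior moves the point where the closure has nonempty interior into int X. *)
have [y [Py Iy]] : exists y : X, (closure (periodic_points T))° y /\ X° (val y).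
  have [|//|y [Py Iy]] := hXdense ((closure (periodic_points T))°).
  - by exists y0.
  - exact: open_interior.
  - by exists y.
have /nbhs_set_typeP[W Wy HW] : nbhs y (closure (periodic_points T)) by exact: Py.
have /nbhs_cube[r r0 Hr] : nbhs (val y) (W `&` X) by exact: filterI.
have [|z eps yz eps0|N N0 HN] := periodic_on_interior A e he u u0 u1 inj X F FX Fmono Finj
    Fcont Fan Xconn (val y) r r0.
- by move=> z /Hr[].
- have [Wz /set_type_ex[z' zz']] := Hr z yz; rewrite -zz' in Wz *.
  have [|p [[k /= k0 kp] zp]] := HW z' Wz [set p : X | cube A (val z') eps (val p)].
    by apply/nbhs_set_typeP; exists (cube A (val z') eps) => //; exact: cube_nbhs.
  exists (val p); split=> //; split; first exact: set_valP.
  by exists k => //; rewrite /F iter_extend_map_val kp.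
(* T^N = id holds on int X; density of int X and continuity of T^N extend it to [X]. *)
exists N; split=> //; apply/seteqP; split=> // x _ /=.
apply/val_inj/(facet_eq A inj) => i; apply/eqP; rewrite -subr_eq0 -normr_le0.
apply/ler_addgt0Pr => eps eps0; rewrite add0r.
have e2 : 0 < eps / 2 by rewrite divr_gt0.
have [W' W'x HW'] := Fcont0 N x _ e2.
have : nbhs x [set z : X | (W' `&` cube A (val x) (eps / 2)) (val z)].
  apply/nbhs_set_typeP; exists (W' `&` cube A (val x) (eps / 2)) => //.
  by apply: filterI => //; exact: cube_nbhs.
rewrite nbhsE => -[B [oB Bx] HB].
have [z [Bz Iz]] := hXdense B (ex_intro _ x Bx) oB.
have [W'z xz] := HB z Bz; have := HW' z W'z i; have := xz i.
have /val_inj -> : val (iter N T z) = val z.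
  by rewrite -iter_extend_map_val; apply: HN; exact/intE.
by move=> /andP[? ?] /andP[? ?]; rewrite ler_norml; apply/andP; split; lra.
Qed.
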